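(* Let $0<\alpha\le\infty$ and let $f$ be a real function on $(-\alpha,\alpha)$. Then $f\in S_{\mathrm{conv}}^{(2)}(-\alpha,\alpha)$ if and only if $f$ is differentiable on $(-\alpha,\alpha)$ and $f'\in\Psi^{(2)}(-\alpha,\alpha)$ $(=S_{\mathrm{mono}}^{(2)}(-\alpha,\alpha))$. Hence, if $f\in S_{\mathrm{conv}}^{(2)}(-\alpha,\alpha)$, then $f$ is continuously differentiable on $(-\alpha,\alpha)$.
   Context: For a real function $f$ on $(-\alpha,\alpha)$ and a real matrix $A=[a_{ij}]$ with all entries in $(-\alpha,\alpha)$, $f[A]:=[f(a_{ij})]$. For real symmetric matrices, $A\ge0$ means positive semidefinite, and $A\ge B$ means $A-B\ge0$. $S_{\mathrm{mono}}^{(n)}(-\alpha,\alpha)$ (resp. $S_{\mathrm{conv}}^{(n)}(-\alpha,\alpha)$) is the set of real functions $f$ on $(-\alpha,\alpha)$ such that, for all symmetric $A,B\in M_n(\mathbb{R})$ with entries in $(-\alpha,\alpha)$, $A\ge B\ge0$ implies $f[A]\ge f[B]$ (resp. implies $f[\lambda A+(1-\lambda)B]\le\lambda f[A]+(1-\lambda)f[B]$ for all $0\le\lambda\le1$). $\Phi(0,\alpha)$ is the set of all nonnegative functions $h$ on $(0,\alpha)$ which are non-decreasing and satisfy $h(\sqrt{st})\le\sqrt{h(s)h(t)}$ for all $s,t\in(0,\alpha)$. $\Psi^{(1)}(-\alpha,\alpha)$ is the set of all measurable real functions $g$ on $(-\alpha,\alpha)$ such that $g|_{(0,\alpha)}\in\Phi(0,\alpha)$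 and $|g(-t)|\le g(t)$ for Lebesgue-a.e. $t\in(0,\alpha)$. $\Psi^{(2)}(-\alpha,\alpha)$ is the set of all real functions $h$ on $(-\alpha,\alpha)$ for which there exists $g\in\Psi^{(1)}(-\alpha,\alpha)$ such that $h(t)-h(0)=\int_0^tg(s)\,ds$ for all $-\alpha<t<\alpha$. *)

(* Defs.v *)
From HB Require Import structures.
From mathcomp Require Import all_boot all_order all_algebra.
From mathcomp Require Import all_classical all_reals all_analysis.
Set Implicit Arguments.
Unset Strict Implicit.
Unset Printing Implicit Defensive.
Import Order.TTheory GRing.Theory Num.Theory.
Import numFieldNormedType.Exports.
Local Open Scope classical_set_scope.
Local Open Scope ring_scope.

(* A real function on (-alpha, alpha) is a total function R -> R of which only
   the values on [symitv alpha] matter: each class of functions below is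
   insensitive to the values outside.  [alpha] ranges over \bar R, so that
   alpha = +oo is allowed. *)
Definition symitv (R : realType) (alpha : \bar R) : set R :=
  [set x | (- alpha < x%:E < alpha)%E].

Definition positv (R : realType) (alpha : \bar R) : set R :=
  [set x | (0 < x%:E < alpha)%E].

Definition symmats (R : realType) (n : nat) (alpha : \bar R) : set 'M[R]_n :=
  [set A | A^T = A /\ forall i j, symitv alpha (A i j)].

Definition psdmx (R : realType) (n : nat) (A : 'M[R]_n) : Prop :=
  A^T = A /\ forall x : 'cV[R]_n, 0 <= (x^T *m A *m x) 0 0.

Definition loewner_ge (R : realType) (n : nat) (A B : 'M[R]_n) : Prop :=
  psdmx (A - B).

Definition Smono (R : realType) (n : nat) (alpha : \bar R) : set (R -> R) :=
  [set f | forall A B : 'M[R]_n, symmats alpha A -> symmats alpha B ->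
    loewner_ge A B -> psdmx B ->
    loewner_ge (map_mx f A) (map_mx f B)].

Definition Sconv (R : realType) (n : nat) (alpha : \bar R) : set (R -> R) :=
  [set f | forall A B : 'M[R]_n, symmats alpha A -> symmats alpha B ->
    loewner_ge A B -> psdmx B ->
    forall l : R, 0 <= l <= 1 ->
    loewner_ge (l *: map_mx f A + (1 - l) *: map_mx f B)
               (map_mx f (l *: A + (1 - l) *: B))].

Definition Phi (R : realType) (alpha : \bar R) : set (R -> R) :=
  [set h | [/\ forall t, positv alpha t -> 0 <= h t,
    forall s t, positv alpha s -> positv alpha t -> s <= t -> h s <= h t &
    forall s t, positv alpha s -> positv alpha t ->
      h (Num.sqrt (s * t)) <= Num.sqrt (h s * h t)]].

(* R with the sigma-algebra of Lebesgue (not just Borel) measurable sets, on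
   which [completed_lebesgue_measure] is defined. *)
Definition lebesgueR (R : realType) :=
  caratheodory_type (mu_ext (wlength (@idfun R))).

Definition lebesgue_measurable_fun (R : realType) (D : set R) (g : R -> R) :=
  @measurable_fun _ _ (lebesgueR R) R D g.

Definition Psi1 (R : realType) (alpha : \bar R) : set (R -> R) :=
  [set g | [/\ lebesgue_measurable_fun (symitv alpha) g,
    Phi alpha g &
    {ae completed_lebesgue_measure,
      forall t : R, positv alpha t -> `|g (- t)| <= g t}]].

(* The oriented integral of g from 0 to t; [Rintegral] is integral over a set
   (and would silently return 0 for an infinite integral; this does not happen
   for g in [Psi1 alpha] and t in [symitv alpha]). *)
Definition oint0 (R : realType) (g : R -> R) (t : R) : R :=
  if 0 <= t then \int[completed_lebesgue_measure]_(s in `[0, t]) g s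
  else - \int[completed_lebesgue_measure]_(s in `[t, 0]) g s.

Definition Psi2 (R : realType) (alpha : \bar R) : set (R -> R) :=
  [set h | exists2 g, Psi1 alpha g &
    forall t, symitv alpha t -> h t - h 0 = oint0 g t].

Definition differentiable_on (R : realType) (alpha : \bar R) (f : R -> R) :=
  forall x, symitv alpha x -> derivable f x 1.

Definition continuously_differentiable_on (R : realType) (alpha : \bar R)
    (f : R -> R) :=
  differentiable_on alpha f /\
  forall x, symitv alpha x -> {for x, continuous (derive1 f)}.

(* Main.v *)
From HB Require Import structures.
Require Import Defs.
From mathcomp Require Import all_boot all_order all_algebra.
From mathcomp Require Import all_classical all_reals all_analysis.
From mathcomp Require Import measurable_realfun ring lra.
Set Implicit Arguments.
Unset Strict Implicit.
Unset Printing Implicit Defensive.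
Import Order.TTheory GRing.Theory Num.Theory.
Import numFieldNormedType.Exports.
Local Open Scope classical_set_scope.
Local Open Scope ring_scope.

(** The two matrix classes of order 2 are described by inequalities between
    scalars, since a real symmetric matrix of order 2 is positive semidefinite
    exactly when its diagonal is nonnegative and the square of the off-diagonal
    entry is at most the product of the diagonal entries ([psd2]).

    Monotonicity.  A function [f] belongs to [Smono 2] if and only if there is
    [g] in [Phi] such that, for 0 < a <= b, f b - f a is at least (b - a) g a,
    and such that [f] is Lipschitz with constant g m on [-m, m].  This property
    is called [controlled] below; it mentions neither matrices nor measures.
    If [f] is in [Smono 2], adding d to all entries of the matrix with diagonal
    s and off-diagonal entry x shows that no increment of [f] over a step d
    starting at a point x of [-s, s] exceeds in absolute value the increment that
    starts at s.  Hence
    [f] is convex on the positive side, the infimum g of its forward slopes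
    controls it ([Smono2_controlled]), and the path from B to (1 + k) B gives the
    multiplicative convexity of g in the limit.  Conversely, if g controls [f]
    and A >= B >= 0, the segment from B to A is cut into small steps; on each of
    them the increments of [f] at the entries form a positive semidefinite matrix
    up to a shift by one step of the diagonal increments, and the increments add
    up to f[A] - f[B] ([controlled_Smono2]).

    Convexity.  If [f] is in [Sconv 2], the defect in the inequality of Jensen
    over a step d from any point of [-s, s] is at most the defect at s.  Adding
    the defects at s, s + d, s + 2d, ... gives a telescoping sum, so that
    the least of them, the one at s, is much smaller than d.  The difference quotients are then Cauchy, and
    [f] is differentiable on the whole interval
    ([jensen_dominated_differentiable]).  Along a segment from B to A the
    quadratic forms of f are convex, so that the Schur product of A - B with
    f'[A] - f'[B] is positive semidefinite; when A - B has rank one and no zero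
    entry this factor can be removed ([Sconv2_derive_Smono2]).  The converse is
    the mean value theorem together with the Schur product
    ([derive_Smono2_Sconv2]).  Thus [f] is in [Sconv 2] if and only if it is
    differentiable and f' is in [Smono 2].

    Integrals.  It remains to identify [Psi2] with the controlled functions.
    An integral of a function of [Psi1] is controlled by its integrand, because
    the integrand is at most g m in absolute value almost everywhere on [-m, m]
    ([Psi2_controlled]).  Conversely a controlled function is locally Lipschitz,
    hence the integral of its almost everywhere derivative, by the theorem of
    Radon and Nikodym applied to a Stieltjes measure that Lebesgue measure
    dominates, and by Lebesgue differentiation ([lipschitz_density]).  At a
    positive point of differentiability the derivative is g, and at its opposite
    the absolute value of the derivative is at most g ([controlled_Psi2]).
    Finally a controlled function is continuous, so f' is continuous when [f] is
    in [Sconv 2]. *)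

(** * Positive semidefinite matrices of order two *)

Section TwoByTwo.
Context {R : realType}.
Implicit Types a b c x y : R.

Definition psd2 a b c := [/\ 0 <= a, 0 <= c & b ^+ 2 <= a * c].

Lemma psd2P a b c : psd2 a b c <->
  forall x y, 0 <= a * x ^+ 2 + 2 * b * x * y + c * y ^+ 2.
Proof.
split=> [[a0 c0 bac] x y|H].
  have [a00|an0] := eqVneq a 0.
    rewrite a00 mul0r in bac *.
    have -> : b = 0 by apply/eqP; rewrite -sqrf_eq0 eq_le sqr_ge0 bac.
    by rewrite !mul0r mulr0 !mul0r !add0r mulr_ge0 ?sqr_ge0.
  have a_gt0 : 0 < a by rewrite lt_def an0.
  rewrite -(pmulr_rge0 _ a_gt0).
  have -> : a * (a * x ^+ 2 + 2 * b * x * y + c * y ^+ 2) =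
    (a * x + b * y) ^+ 2 + (a * c - b ^+ 2) * y ^+ 2 by ring.
  by rewrite addr_ge0 ?sqr_ge0// mulr_ge0 ?sqr_ge0// subr_ge0.
have a0 : 0 <= a by have := H 1 0; nra.
have c0 : 0 <= c by have := H 0 1; nra.
split=> //.
have [a00|an0] := eqVneq a 0.
  have [->|bn0] := eqVneq b 0; first by rewrite expr0n/= mulr_ge0.
  have := H (- (c + 1) / (2 * b)) 1; rewrite a00.
  have -> : 0 * (- (c + 1) / (2 * b)) ^+ 2 + 2 * b * (- (c + 1) / (2 * b)) * 1
     + c * 1 ^+ 2 = -1 :> R by field.
  lra.
have a_gt0 : 0 < a by rewrite lt_def an0.
have := H b (- a).
have -> : a * b ^+ 2 + 2 * b * b * - a + c * (- a) ^+ 2 =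
  a * (a * c - b ^+ 2) by ring.
by rewrite pmulr_rge0// subr_ge0.
Qed.

Lemma psd2D a b c a' b' c' : psd2 a b c -> psd2 a' b' c' ->
  psd2 (a + a') (b + b') (c + c').
Proof.
move=> /psd2P H /psd2P H'; apply/psd2P => x y.
have := H x y; have := H' x y; lra.
Qed.

Lemma psd2Z k a b c : 0 <= k -> psd2 a b c -> psd2 (k * a) (k * b) (k * c).
Proof.
move=> k0 [a0 c0 bac]; split; rewrite ?mulr_ge0//.
rewrite [leRHS](_ : _ = k ^+ 2 * (a * c)); last by ring.
by rewrite exprMn ler_wpM2l// sqr_ge0.
Qed.

Lemma psd2M a b c a' b' c' : psd2 a b c -> psd2 a' b' c' ->
  psd2 (a * a') (b * b') (c * c').
Proof.
move=> [a0 c0 bac] [a'0 c'0 bac']; split; rewrite ?mulr_ge0//.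
rewrite [leRHS](_ : _ = (a * c) * (a' * c')); last by ring.
by rewrite exprMn ler_pM// sqr_ge0.
Qed.

Lemma psd2_le a b c a' c' : a <= a' -> c <= c' -> psd2 a b c -> psd2 a' b c'.
Proof.
move=> aa' cc' [a0 c0 bac]; split; [lra|lra|].
by apply: (le_trans bac); apply: ler_pM.
Qed.

Lemma psd2_normE a b c : psd2 a b c <->
  [/\ 0 <= a, 0 <= c & `|b| <= Num.sqrt (a * c)].
Proof.
split=> -[a0 c0 bac]; split=> //.
  by rewrite -sqrtr_sqr ler_sqrt// mulr_ge0.
by rewrite -[leRHS]sqr_sqrtr ?mulr_ge0// -real_normK ?num_real//
  ler_pXn2r ?nnegrE ?sqrtr_ge0.
Qed.

Lemma psd2_norm_le_max a b c : psd2 a b c -> `|b| <= Num.max a c.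
Proof.
move=> [a0 c0 bac].
have m0 : 0 <= Num.max a c by rewrite le_max a0.
rewrite -(@ler_pXn2r _ 2)// ?nnegrE// real_normK ?num_real// (le_trans bac)//.
by rewrite expr2 ler_pM// le_max lexx ?orbT.
Qed.

Definition sym2 a b c : 'M[R]_2 :=
  \matrix_(i, j) if i == j then (if i == 0 then a else c) else b.

Lemma sym2_eta (A : 'M[R]_2) : A^T = A -> A = sym2 (A 0 0) (A 0 1) (A 1 1).
Proof.
move=> sA; apply/matrixP => i j; rewrite mxE.
have A10 : A 1 0 = A 0 1 by rewrite -{1}sA mxE.
have ord2 (k : 'I_2) : k = 0 \/ k = 1.
  by case: k => -[|[|//]] ?; [left|right]; apply/val_inj.
by case: (ord2 i) => ->; case: (ord2 j) => ->.
Qed.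

Lemma psdmx_sym2 a b c : psdmx (sym2 a b c) <-> psd2 a b c.
Proof.
rewrite psd2P; split=> [[_ H] x y|H].
  have := H (\col_i if i == 0 then x else y).
  rewrite !mxE !big_ord_recl big_ord0 !mxE !big_ord_recl !big_ord0 !mxE/=.
  by congr (0 <= _); ring.
split=> [|x].
  by apply/matrixP => i j; rewrite !mxE eq_sym; case: eqP => // ->.
rewrite !mxE !big_ord_recl big_ord0 !mxE !big_ord_recl !big_ord0 !mxE/=.
set u := x _ _; set v := x _ _.
rewrite (_ : _ + _ = a * u ^+ 2 + 2 * b * u * v + c * v ^+ 2); first exact: H.
by ring.
Qed.

End TwoByTwo.

(** * The interval and the scalar forms of the two classes *)

Section SymmetricInterval.
Context {R : realType} (alpha : \bar R).
Implicit Types a b c x y l : R.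

Lemma symitv_abs x : symitv alpha x <-> (`|x|%:E < alpha)%E.
Proof.
rewrite /symitv/=; case: alpha => [r| |]/=.
- by rewrite !lte_fin -ltr_norml.
- by rewrite ltNyr !ltry.
- by split=> //; rewrite ltNge leNye.
Qed.

Lemma symitv_le x y : symitv alpha y -> `|x| <= `|y| -> symitv alpha x.
Proof.
by move=> /symitv_abs ya xy; apply/symitv_abs/(le_lt_trans _ ya); rewrite lee_fin.
Qed.

Lemma positvE x : positv alpha x <-> 0 < x /\ symitv alpha x.
Proof.
rewrite /positv/= lte_fin; split=> [/andP[x0 xa]|[x0 /symitv_abs]].
  by split=> //; apply/symitv_abs; rewrite gtr0_norm.
by rewrite gtr0_norm// x0.
Qed.

Lemma positv_sym x : positv alpha x -> symitv alpha x.
Proof. by case/positvE. Qed.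

Lemma positv_gt0 x : positv alpha x -> 0 < x.
Proof. by case/positvE. Qed.

Lemma positv_le x y : positv alpha y -> 0 < x -> x <= y -> positv alpha x.
Proof.
move=> /positvE[y0 sy] x0 xy; apply/positvE; split=> //.
by apply: symitv_le sy _; rewrite !gtr0_norm.
Qed.

Lemma symitv_between x m : positv alpha m -> - m <= x -> x <= m ->
  symitv alpha x.
Proof.
move=> /positvE[m0 sm] mx xm; apply: symitv_le sm _.
by rewrite (gtr0_norm m0) ler_norml mx.
Qed.

Lemma symitv_conv l x y : 0 <= l <= 1 -> symitv alpha x -> symitv alpha y ->
  symitv alpha (l * x + (1 - l) * y).
Proof.
move=> /andP[l0 l1] sx sy; have l10 : 0 <= 1 - l by rewrite subr_ge0.
have [xy|yx] := leP `|x| `|y|; [apply: symitv_le sy _|apply: symitv_le sx _];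
  rewrite (le_trans (ler_normD _ _))// !normrM (ger0_norm l0) (ger0_norm l10).
- rewrite [leRHS](_ : _ = l * `|y| + (1 - l) * `|y|); last by ring.
  by rewrite lerD2r ler_wpM2l.
- rewrite [leRHS](_ : _ = l * `|x| + (1 - l) * `|x|); last by ring.
  by rewrite lerD2l ler_wpM2l// ltW.
Qed.

Lemma symitv_lt_exists x : (0 < alpha)%E -> symitv alpha x ->
  exists2 m, positv alpha m & `|x| < m.
Proof.
move=> a0 /symitv_abs xa.
suff [m /andP[xm ma]] : exists m, ((`|x|%:E < m%:E) && (m%:E < alpha))%E.
  rewrite lte_fin in xm; exists m => //; apply/andP; split=> //.
  by rewrite lte_fin (le_lt_trans _ xm).
case: alpha xa a0 => [r| |]//= xa a0.
  by exists ((`|x| + r) / 2); rewrite !lte_fin in xa *; apply/andP; split; lra.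
by exists (`|x| + 1); rewrite ltry andbT lte_fin ltrDl.
Qed.

End SymmetricInterval.

Section ScalarForms.
Context {R : realType} (alpha : \bar R).
Implicit Types (a b c x y l : R) (f : R -> R).

(** The defect in the inequality of Jensen for the pair x, y with weight l: it
    is nonnegative when f is convex. *)
Definition jensen f l x y := l * f x + (1 - l) * f y - f (l * x + (1 - l) * y).

(** The entries of a pair A >= B >= 0: the diagonal a, c and the off-diagonal
    entry b of A, and those of B.  The diagonal of A bounds every other entry in
    absolute value, so the condition on the interval is put on it alone. *)
Definition loewner_pair a b c a' b' c' :=
  [/\ symitv alpha a, symitv alpha c,
      psd2 (a - a') (b - b') (c - c') & psd2 a' b' c'].

Lemma loewner_pair_psd2 a b c a' b' c' : loewner_pair a b c a' b' c' ->
  psd2 a b c.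
Proof. by case=> _ _ /psd2D H /H; rewrite !subrK. Qed.

Lemma loewner_pair_sym a b c a' b' c' : loewner_pair a b c a' b' c' ->
  symitv alpha a' /\ symitv alpha c'.
Proof.
case=> sa sc [ga gc _] [a0 c0 _].
by split; [apply: symitv_le sa _|apply: symitv_le sc _]; rewrite !ger0_norm; lra.
Qed.

Lemma psd2_symitv a b c : symitv alpha a -> symitv alpha c -> psd2 a b c ->
  symitv alpha b.
Proof.
move=> sa sc H; have := psd2_norm_le_max H; case: H => a0 c0 _.
rewrite le_max => /orP[ba|bc]; [apply: symitv_le sa _|apply: symitv_le sc _];
  by rewrite [leRHS]ger0_norm.
Qed.

Let symmats2 a b c : symitv alpha a -> symitv alpha b -> symitv alpha c ->
  symmats alpha (sym2 a b c).
Proof.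
move=> sa sb sc; split.
  by apply/matrixP => i j; rewrite !mxE eq_sym; case: eqP => // ->.
by move=> i j; rewrite mxE; case: ifP => // _; case: ifP.
Qed.

Lemma Smono2P f : Smono 2 alpha f <-> forall a b c a' b' c',
  loewner_pair a b c a' b' c' -> psd2 (f a - f a') (f b - f b') (f c - f c').
Proof.
have E a b c a' b' c' :
    map_mx f (sym2 a b c) - map_mx f (sym2 a' b' c') =
    sym2 (f a - f a') (f b - f b') (f c - f c').
  by apply/matrixP => i j; rewrite !mxE; case: ifP => // _; case: ifP.
have S a b c a' b' c' : sym2 a b c - sym2 a' b' c' =
    sym2 (a - a') (b - b') (c - c') :> 'M[R]_2.
  by apply/matrixP => i j; rewrite !mxE; case: ifP => // _; case: ifP.
split=> [H a b c a' b' c' P|H A B [sA iA] [sB iB]].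
  have pA := loewner_pair_psd2 P; have [sa' sc'] := loewner_pair_sym P.
  case: P => sa sc pD pB.
  apply/psdmx_sym2; rewrite -E; apply: H; try apply: symmats2 => //.
  - exact: psd2_symitv pA.
  - exact: psd2_symitv pB.
  - by rewrite /loewner_ge S; apply/psdmx_sym2.
  - exact/psdmx_sym2.
rewrite (sym2_eta sA) (sym2_eta sB) /loewner_ge S E => /psdmx_sym2 pD /psdmx_sym2 pB.
by apply/psdmx_sym2/H; split.
Qed.

Lemma Sconv2P f : Sconv 2 alpha f <-> forall a b c a' b' c' l,
  loewner_pair a b c a' b' c' -> 0 <= l <= 1 ->
  psd2 (jensen f l a a') (jensen f l b b') (jensen f l c c').
Proof.
have E l a b c a' b' c' :
    l *: map_mx f (sym2 a b c) + (1 - l) *: map_mx f (sym2 a' b' c')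
      - map_mx f (l *: sym2 a b c + (1 - l) *: sym2 a' b' c') =
    sym2 (jensen f l a a') (jensen f l b b') (jensen f l c c').
  by apply/matrixP => i j; rewrite !mxE; case: ifP => // _; case: ifP.
have S a b c a' b' c' : sym2 a b c - sym2 a' b' c' =
    sym2 (a - a') (b - b') (c - c') :> 'M[R]_2.
  by apply/matrixP => i j; rewrite !mxE; case: ifP => // _; case: ifP.
split=> [H a b c a' b' c' l P l01|H A B [sA iA] [sB iB]].
  have pA := loewner_pair_psd2 P; have [sa' sc'] := loewner_pair_sym P.
  case: P => sa sc pD pB.
  apply/psdmx_sym2; rewrite -E; apply: H => //; try apply: symmats2 => //.
  - exact: psd2_symitv pA.
  - exact: psd2_symitv pB.
  - by rewrite /loewner_ge S; apply/psdmx_sym2.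
  - exact/psdmx_sym2.
rewrite (sym2_eta sA) (sym2_eta sB) /loewner_ge S => /psdmx_sym2 pD /psdmx_sym2 pB.
by move=> l l01; rewrite E; apply/psdmx_sym2/H => //; split.
Qed.

End ScalarForms.

(** * From operator monotonicity to a controlling function *)

Section Sums.
Context {R : realType}.

Lemma le_of_natSinv (x y K : R) : (forall n : nat, x <= y + K / n.+1%:R) -> x <= y.
Proof.
move=> H; apply/ler_addgt0Pr => e e0.
have K0 : 0 < `|K| + 1 by rewrite ltr_wpDl.
have [n ne] : exists n : nat, (`|K| + 1) / e < n.+1%:R.
  exists (Num.bound ((`|K| + 1) / e)).
  by rewrite (lt_le_trans (archi_boundP _))// ?divr_ge0 ?ler_nat// ltW.
apply: (le_trans (H n)); rewrite lerD2l ler_pdivrMr//.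
rewrite ltr_pdivrMr// mulrC in ne; apply/ltW/(le_lt_trans _ ne).
by rewrite (le_trans (ler_norm _))// lerDl.
Qed.

Lemma mulr_natSl (k : nat) (d : R) : k.+1%:R * d = k%:R * d + d.
Proof. by rewrite -addn1 natrD mulrDl mul1r. Qed.

Lemma psd2_sum (a b c : nat -> R) n :
  (forall k, (k < n)%N -> psd2 (a k) (b k) (c k)) ->
  psd2 (\sum_(k < n) a k) (\sum_(k < n) b k) (\sum_(k < n) c k).
Proof.
elim: n => [|n IH] H; first by rewrite !big_ord0; split; rewrite ?expr0n ?mulr0.
rewrite !big_ord_recr; apply: psd2D; last exact: H.
by apply: IH => k kn; apply/H/ltnW.
Qed.

End Sums.

Section Controlled.
Context {R : realType} (alpha : \bar R).
Implicit Types (f g : R -> R) (x y z w s d m : R).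

(** The values of g are slopes of support lines of f on the positive side, and
    g m is also a Lipschitz constant of f on [-m, m]. *)
Definition controlled g f :=
  (forall a b, positv alpha a -> positv alpha b -> a <= b ->
     (b - a) * g a <= f b - f a) /\
  (forall m x y, positv alpha m -> - m <= x -> x <= y -> y <= m ->
     `|f y - f x| <= (y - x) * g m).

Definition increments_dominated f := forall x s d, `|x| <= s -> 0 <= d ->
  symitv alpha (s + d) -> `|f (x + d) - f x| <= f (s + d) - f s.

(** The matrices [s + d, x + d; x + d, s + d] >= [s, x; x, s] >= 0 differ by d
    times the matrix of ones, and the last inequality is |x| <= s. *)
Lemma Smono2_increments f : Smono 2 alpha f -> increments_dominated f.
Proof.
move=> /Smono2P H x s d xs d0 ssd.
have s0 : 0 <= s by rewrite (le_trans _ xs).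
have := H (s + d) (x + d) (s + d) s x s.
case=> [|F0 _].
  split=> //; first by rewrite !(addrC _ d) !addrK; split.
  by split=> //; rewrite -expr2 -(real_normK (num_real x)) ler_pXn2r ?nnegrE.
rewrite -expr2 -(real_normK (num_real (_ - f x))) ler_pXn2r ?nnegrE//.
Qed.

Lemma increments_nondecreasing f s t : increments_dominated f ->
  symitv alpha t -> 0 <= s -> s <= t -> f s <= f t.
Proof.
move=> H st s0 s_t; rewrite -subr_ge0.
have := H s s (t - s); rewrite subrKC (ger0_norm s0).
by rewrite -subr_ge0 in s_t; move=> /(_ (lexx s) s_t st); apply: le_trans.
Qed.

Lemma telescope_increments (u : R -> R) x d n B :
  (forall k, (k < n)%N -> `|u (x + k%:R * d + d) - u (x + k%:R * d)| <= B) ->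
  `|u (x + n%:R * d) - u x| <= n%:R * B.
Proof.
elim: n => [|n IH] H; first by rewrite !mul0r addr0 subrr normr0.
have -> : u (x + n.+1%:R * d) - u x =
  (u (x + n%:R * d + d) - u (x + n%:R * d)) + (u (x + n%:R * d) - u x).
  by rewrite mulr_natSl addrA; ring.
rewrite (le_trans (ler_normD _ _))// mulrSr mulrDl mul1r addrC lerD//.
  by apply: IH => k kn; apply/H/ltnW.
exact: H.
Qed.

Lemma telescope_increments_ge (u : R -> R) x d n B :
  (forall k, (k < n)%N -> B <= u (x + k%:R * d + d) - u (x + k%:R * d)) ->
  n%:R * B <= u (x + n%:R * d) - u x.
Proof.
elim: n => [|n IH] H; first by rewrite !mul0r addr0 subrr.
have -> : u (x + n.+1%:R * d) - u x =
  (u (x + n%:R * d + d) - u (x + n%:R * d)) + (u (x + n%:R * d) - u x).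
  by rewrite mulr_natSl addrA; ring.
rewrite mulrSr mulrDl mul1r addrC lerD//; first exact: H.
by apply: IH => k kn; apply/H/ltnW.
Qed.

(** Cut [x, y] into n equal steps of length d.  Each increment of f there is at
    most the one over [z, z + d], and this is at most each of the successive
    increments inside [z, w], about (w - z) / d in number.  The loss of one
    incomplete step disappears when n tends to infinity. *)
Lemma increments_slope f x y z w : increments_dominated f ->
  - z <= x -> x < y -> y <= z -> z < w -> symitv alpha w ->
  `|f y - f x| * (w - z) <= (f w - f z) * (y - x).
Proof.
move=> H zx xy yz zw sw.
have p0 : 0 < y - x by lra.
have r0 : 0 < w - z by lra.
have z0 : 0 <= z by lra.
have fzw : 0 <= f w - f z.
  by rewrite subr_ge0; apply: increments_nondecreasing => //; exact: ltW.
set D := `|f y - f x|; set p := y - x in p0 *; set r := w - z in r0 *.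
rewrite mulrC.
apply: (@le_of_natSinv _ _ _ (p * D)) => n.
set N := n.+1%:R; have N0 : 0 < N :> R by rewrite ltr0n.
pose d := p / N; have d0 : 0 < d by rewrite divr_gt0.
(* the number of complete steps of length d inside [z, w] *)
pose M := Num.truncn (r / d).
have rd0 : 0 <= r / d by rewrite divr_ge0// ltW.
have Mle : M%:R * d <= r by rewrite -ler_pdivlMr// truncn_le.
have Mgt : r < M.+1%:R * d by rewrite -ltr_pdivrMr// truncnS_gt.
have xNd : x + N * d = y by rewrite /d mulrC divfK ?gt_eqF// /p; ring.
have main : M%:R * D <= N * (f w - f z).
  have [->|M0] := posnP M; first by rewrite mul0r mulr_ge0// ltW.
  have M1 : 1 <= M%:R :> R by rewrite ler1n.
  have dr : d <= r by apply: le_trans Mle; rewrite ler_peMl// ltW.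
  have DB : D <= N * (f (z + d) - f z).
    rewrite /D -xNd; apply: telescope_increments => k kn.
    have kd : k%:R * d + d <= p.
      rewrite -mulr_natSl -[p](divfK (lt0r_neq0 N0)) -/d mulrC ler_wpM2l ?(ltW d0)//.
      by rewrite ler_nat.
    have kd0 : 0 <= k%:R * d by rewrite mulr_ge0// ltW.
    apply: H; [|exact: ltW|].
      by rewrite ler_norml; apply/andP; split; rewrite /p in kd; lra.
    by apply: symitv_le sw _; rewrite !ger0_norm; rewrite /r in dr; lra.
  have BF : M%:R * (f (z + d) - f z) <= f w - f z.
    apply: (@le_trans _ _ (f (z + M%:R * d) - f z)); last first.
      rewrite lerD2r; apply: increments_nondecreasing => //.
        by rewrite addr_ge0// mulr_ge0// ltW.
      by rewrite /r in Mle; lra.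
    apply: telescope_increments_ge => k kM.
    have kd : k%:R * d + d <= r.
      apply: le_trans Mle; rewrite -mulr_natSl ler_wpM2r ?(ltW d0)//.
      by rewrite ler_nat.
    have kd0 : 0 <= k%:R * d by rewrite mulr_ge0// ltW.
    rewrite (le_trans (ler_norm _))//; apply: H; [|exact: ltW|].
      by rewrite ger0_norm// lerDl.
    by apply: symitv_le sw _; rewrite !ger0_norm; rewrite /r in kd; lra.
  rewrite (le_trans (ler_wpM2l _ DB))// mulrCA ler_wpM2l// ltW//.
have D0 : 0 <= D by exact: normr_ge0.
have : r * D <= (M%:R * d + d) * D.
  by rewrite ler_wpM2r// ltW// -mulr_natSl.
have e1 : d * (M%:R * D) <= (f w - f z) * p.
  have -> : (f w - f z) * p = d * (N * (f w - f z)).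
    by rewrite /d; field; rewrite gt_eqF.
  by rewrite ler_wpM2l// ltW.
have -> : p * D / N = d * D by rewrite /d; field; rewrite gt_eqF.
lra.
Qed.


Lemma slope_mono f s w w' : increments_dominated f -> 0 <= s -> s < w' -> w' <= w ->
  symitv alpha w -> (f w' - f s) / (w' - s) <= (f w - f s) / (w - s).
Proof.
move=> H s0 sw'; rewrite le_eqVlt => /orP[/eqP->//|w'w] sw.
have w's : 0 < w' - s by rewrite subr_gt0.
have ws : 0 < w - s by rewrite subr_gt0 (lt_trans sw').
rewrite ler_pdivrMr// mulrAC ler_pdivlMr//.
have := increments_slope H _ sw' (lexx w') w'w sw.
have -> : - w' <= s by lra.
move=> /(_ isT); set F := _ - f s => K.
have : F * (w - w') <= (f w - f w') * (w' - s).
  by apply: le_trans K; rewrite ler_wpM2r ?ler_norm// subr_ge0 ltW.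
by rewrite /F; nra.
Qed.

(** Where f is convex this is its right derivative, but no limit is needed to
    define it. *)
Definition lower_slope f a :=
  inf [set (f w - f a) / (w - a) | w in [set w | a < w /\ symitv alpha w]].

Section LowerSlope.
Hypothesis alpha_gt0 : (0 < alpha)%E.
Variable f : R -> R.
Hypothesis domf : increments_dominated f.

Let has_inf_slopes a : positv alpha a ->
  has_inf [set (f w - f a) / (w - a) | w in [set w | a < w /\ symitv alpha w]].
Proof.
move=> /positvE[a0 sa]; split.
  have [m /positvE[m0 sm] am] := symitv_lt_exists alpha_gt0 sa.
  by exists ((f m - f a) / (m - a)), m => //; split=> //; rewrite -(gtr0_norm a0).
exists 0 => _ [w [aw sw] <-]; rewrite divr_ge0 ?subr_ge0 ?(ltW aw)//.
by apply: (increments_nondecreasing domf) => //; exact: ltW.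
Qed.

Lemma lower_slope_le a w : positv alpha a -> a < w -> symitv alpha w ->
  lower_slope f a <= (f w - f a) / (w - a).
Proof. by move=> pa aw sw; apply: ge_inf; [case: (has_inf_slopes pa)|exists w]. Qed.

Lemma lower_slope_ge a B : positv alpha a ->
  (forall w, a < w -> symitv alpha w -> B <= (f w - f a) / (w - a)) ->
  B <= lower_slope f a.
Proof.
move=> pa H; apply: lb_le_inf; first by case: (has_inf_slopes pa).
by move=> _ [w [aw sw] <-]; exact: H.
Qed.

Lemma lower_slope_controlled : controlled (lower_slope f) f.
Proof.
split=> [a b pa pb|m x y pm mx].
  rewrite le_eqVlt => /orP[/eqP->|ab]; first by rewrite !subrr mul0r.
  by rewrite mulrC -ler_pdivlMr ?subr_gt0//; apply: lower_slope_le => //; case/positvE: pb.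
rewrite le_eqVlt => /orP[/eqP->|xy ym]; first by rewrite !subrr normr0 mul0r.
rewrite mulrC -ler_pdivrMr ?subr_gt0//; apply: lower_slope_ge => // w mw sw.
rewrite ler_pdivrMr ?subr_gt0// mulrAC ler_pdivlMr ?subr_gt0//.
exact: (increments_slope domf).
Qed.

(** Forward slopes decrease to their infimum when the step shrinks. *)
Lemma lower_slope_approx s e : positv alpha s -> 0 < e -> exists2 w, positv alpha w &
  s < w /\ forall w', s < w' -> w' <= w ->
    (f w' - f s) / (w' - s) <= lower_slope f s + e.
Proof.
move=> ps e0; have [_ [w [sw sw'] <-] we] := inf_adherent e0 (has_inf_slopes ps).
have s0 := positv_gt0 ps.
exists w; first by apply/positvE; split=> //; lra.
split=> // w' sw1 w'w; apply: le_trans (ltW we).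
by apply: (slope_mono domf) => //; exact: ltW.
Qed.

End LowerSlope.

(** The controlling function is multiplicatively convex because f[(1 + k) B] -
    f[B] is positive semidefinite for B = [s, u; u, t] with u ^ 2 = s t: after
    division by k B entrywise, the slopes of f at s, u, t satisfy the inequality
    that defines [Phi], up to an error that vanishes with k. *)
Lemma Smono2_controlled f : (0 < alpha)%E -> Smono 2 alpha f ->
  Phi alpha (lower_slope f) /\ controlled (lower_slope f) f.
Proof.
move=> alpha_gt0 fS; have domf := Smono2_increments fS.
have [C1 C2] := lower_slope_controlled alpha_gt0 domf.
have g0 a : positv alpha a -> 0 <= lower_slope f a.
  move=> pa; apply: lower_slope_ge => // w aw sw.
  have a0 := positv_gt0 pa.
  rewrite divr_ge0 ?subr_ge0 ?(ltW aw)//.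
  by apply: (increments_nondecreasing domf) => //; exact: ltW.
split=> //; split=> // [s t ps pt|s t ps pt].
  rewrite le_eqVlt => /orP[/eqP->//|st].
  have s0 := positv_gt0 ps.
  have := le_trans (C1 _ _ ps pt (ltW st))
    (le_trans (ler_norm _) (C2 t s t pt _ (ltW st) (lexx t))).
  by rewrite ler_pM2l ?subr_gt0//; apply; lra.
set u := Num.sqrt _.
have s0 := positv_gt0 ps; have t0 := positv_gt0 pt.
have u0 : 0 < u by rewrite sqrtr_gt0 mulr_gt0.
have u2 : u ^+ 2 = s * t by rewrite sqr_sqrtr// ltW// mulr_gt0.
have ust : psd2 s u t by split; [exact: ltW|exact: ltW|rewrite u2].
have pu : positv alpha u.
  by apply/positvE; split=> //; apply: psd2_symitv ust; exact: positv_sym.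
have H e : 0 < e ->
    lower_slope f u ^+ 2 <= (lower_slope f s + e) * (lower_slope f t + e).
  move=> e0.
  have [ws pws [sws Hs]] := lower_slope_approx alpha_gt0 domf ps e0.
  have [wt pwt [twt Ht]] := lower_slope_approx alpha_gt0 domf pt e0.
  (* small enough for (1 + k) s and (1 + k) t to be good approximation points *)
  pose k := Num.min ((ws - s) / s) ((wt - t) / t).
  have k0 : 0 < k by rewrite lt_min !divr_gt0// subr_gt0.
  have ks : s + k * s <= ws.
    by rewrite -lerBrDl -ler_pdivlMr// ge_min lexx.
  have kt : t + k * t <= wt.
    by rewrite -lerBrDl -ler_pdivlMr// ge_min lexx orbT.
  have ks0 : 0 < k * s by rewrite mulr_gt0.
  have kt0 : 0 < k * t by rewrite mulr_gt0.
  have ku0 : 0 < k * u by rewrite mulr_gt0.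
  have pks : positv alpha (s + k * s) by apply: positv_le pws _ ks; rewrite addr_gt0.
  have pkt : positv alpha (t + k * t) by apply: positv_le pwt _ kt; rewrite addr_gt0.
  have pair : loewner_pair alpha (s + k * s) (u + k * u) (t + k * t) s u t.
    split=> //; [exact: positv_sym|exact: positv_sym|].
    rewrite ![_ + k * _ - _]addrAC !subrr !add0r.
    by apply: psd2Z => //; exact: ltW.
  have sku : symitv alpha (u + k * u).
    apply: psd2_symitv (loewner_pair_psd2 pair); exact: positv_sym.
  have [_ _ Suv] := (Smono2P alpha f).1 fS _ _ _ _ _ _ pair.
  have Lu := lower_slope_le alpha_gt0 domf pu _ sku.
  have Ls := Hs (s + k * s) _ ks.
  have Lt := Ht (t + k * t) _ kt.
  rewrite !ltrDl ks0 kt0 ku0 ![_ + k * _ - _]addrAC !subrr !add0r in Ls Lt Lu.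
  have {}Lu := Lu isT; have {}Ls := Ls isT; have {}Lt := Lt isT.
  have gu := g0 _ pu.
  have [gs gt] := (g0 _ ps, g0 _ pt).
  apply: (@le_trans _ _ (((f (u + k * u) - f u) / (k * u)) ^+ 2)).
    by rewrite ler_pXn2r ?nnegrE// (le_trans gu).
  apply: (@le_trans _ _ (((f (s + k * s) - f s) / (k * s)) *
      ((f (t + k * t) - f t) / (k * t)))).
    have -> : ((f (s + k * s) - f s) / (k * s)) *
        ((f (t + k * t) - f t) / (k * t)) =
       (f (s + k * s) - f s) * (f (t + k * t) - f t) / (k * u) ^+ 2.
      by rewrite [in RHS]exprMn u2; field; rewrite !gt_eqF.
    by rewrite expr_div_n ler_pM2r// invr_gt0 exprn_gt0.
  apply: ler_pM => //; rewrite divr_ge0 ?(ltW ks0) ?(ltW kt0)//.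
    by rewrite subr_ge0; apply: (increments_nondecreasing domf) => //;
    [exact: positv_sym|exact: ltW|lra].
  by rewrite subr_ge0; apply: (increments_nondecreasing domf) => //;
    [exact: positv_sym|exact: ltW|lra].
have [gs gt] := (g0 _ ps, g0 _ pt).
rewrite -(@ger0_norm _ (lower_slope f u)) ?g0// -sqrtr_sqr ler_sqrt ?mulr_ge0//.
apply/ler_addgt0Pr => e e0.
(* (gs + d) (gt + d) <= gs gt + d (gs + gt + 1) when d <= 1 *)
pose S := lower_slope f s + lower_slope f t + 1.
have S0 : 0 < S by rewrite ltr_wpDl// addr_ge0.
pose d := Num.min 1 (e / S).
have d0 : 0 < d by rewrite lt_min ltr01 divr_gt0.
have d1 : d <= 1 by rewrite ge_min lexx.
have dS : d * S <= e by rewrite -ler_pdivlMr// ge_min lexx orbT.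
apply: (le_trans (H d d0)); rewrite /S in dS; nra.
Qed.

(** The support inequality holds at positive points, so 0 needs an argument: when
    t = 2 h, the increment over [0, h] is at least - h g h by the Lipschitz bound,
    and the increment over [h, 2h] is at least h g h. *)
Lemma controlled_nondecreasing f g s t : controlled g f -> Phi alpha g ->
  positv alpha t -> 0 <= s -> s <= t -> f s <= f t.
Proof.
move=> [C1 C2] [g0 _ _] pt s0; rewrite le_eqVlt => /orP[/eqP->//|st].
have pos x y : positv alpha y -> 0 < x -> x <= y -> f x <= f y.
  move=> py x0 xy; have px := positv_le py x0 xy.
  rewrite -subr_ge0; apply: le_trans (C1 _ _ px py xy).
  by rewrite mulr_ge0 ?subr_ge0 ?g0.
move: s0; rewrite le_eqVlt => /orP[/eqP s0|s0]; last by apply: pos => //; exact: ltW.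
rewrite -s0 in st *; set h := t / 2.
have h0 : 0 < h by rewrite divr_gt0.
have ht : h <= t by rewrite /h; lra.
have ph := positv_le pt h0 ht.
have := C1 _ _ ph pt ht.
have := C2 h 0 h ph _ (ltW h0) (lexx h).
rewrite oppr_le0 ltW// subr0 => /(_ isT) /ler_normlP[]; rewrite /h; nra.
Qed.
End Controlled.

(** * From a controlling function to operator monotonicity *)

Section ControlledSmono.
Context {R : realType} (alpha : \bar R).
Implicit Types (f g : R -> R) (x y z w s d m : R).

(** Along a path of positive semidefinite matrices with growing diagonal, the
    off-diagonal entry at a given time is dominated by the diagonal at any later
    time. *)
Lemma psd2_path_le a b c p q r (k k' : R) : psd2 a b c -> psd2 p q r ->
  0 <= k -> k <= k' ->
  `|b + k * q| <= Num.sqrt ((a + k' * p) * (c + k' * r)).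
Proof.
move=> H H' k0 kk'.
have [|p0 r0 bk] := (psd2_normE (a + k * p) (b + k * q) (c + k * r)).1 _.
  by apply: psd2D => //; exact: psd2Z.
case: H => a0 c0 _; case: H' => p'0 r'0 _.
apply: (le_trans bk); rewrite ler_sqrt.
  by rewrite ler_pM// lerD2l ler_wpM2r.
by rewrite mulr_ge0// addr_ge0// mulr_ge0// (le_trans k0).
Qed.

(** With N steps of size 1 / N, write A k, B k, C k for the entries after k steps
    and M for the geometric mean of A (k + 1) and C (k + 1).  The off-diagonal
    increment over step k is at most |q| g M / N, since both B k and B (k + 1)
    lie in [-M, M]; g M is at most the geometric mean of g (A (k + 1)) and
    g (C (k + 1)); and these are lower bounds of the diagonal slopes over
    step k + 1.  The sum misses the first diagonal increment, which is
    nonnegative, and the last off-diagonal one, which is O(1 / N). *)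
Lemma controlled_Smono2 g f : Phi alpha g -> controlled alpha g f -> Smono 2 alpha f.
Proof.
move=> Pg Cg; have mono := controlled_nondecreasing Cg Pg.
have [g0 gnd gsqrt] := Pg; have [C1 C2] := Cg.
apply/Smono2P => a b c a' b' c' pair.
have pA := loewner_pair_psd2 pair.
have [sa' sc'] := loewner_pair_sym pair.
case: pair => sa sc pD pB.
have [p0 r0 _] := pD; have [a'0 c'0 b'le] := pB.
rewrite !subr_ge0 in p0 r0.
(* if the off-diagonal entry moves, both diagonal entries move, and the paths
   below are positive after the first step *)
have [b'E|/eqP bn] := eqVneq b b'.
  rewrite b'E subrr.
  have pos s t : symitv alpha t -> 0 <= s -> s <= t -> 0 <= f t - f s.
    move=> st s0; rewrite subr_ge0 le_eqVlt => /orP[/eqP->//|st'].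
    by apply: mono => //; [apply/positvE; split=> //; lra|exact: ltW].
  by split; rewrite ?pos// expr0n/= mulr_ge0// pos.
have [pgt rgt] : a' < a /\ c' < c.
  case: pD => _ _ bac.
  have q2 : 0 < (b - b') ^+ 2.
    by rewrite lt_def sqr_ge0 sqrf_eq0 subr_eq0 andbT; apply/eqP.
  by split; rewrite lt_neqAle ?p0 ?r0 andbT; apply/eqP => E;
    move: (lt_le_trans q2 bac); rewrite E subrr ?mul0r ?mulr0 ltxx.
have a_gt0 : 0 < a by lra.
have c_gt0 : 0 < c by lra.
have pa : positv alpha a by apply/positvE.
have pc : positv alpha c by apply/positvE.
set p := a - a' in pD; set q := b - b' in pD; set r := c - c' in pD.
have p_gt0 : 0 < p by rewrite subr_gt0.
have r_gt0 : 0 < r by rewrite subr_gt0.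
apply/psd2_normE; rewrite !subr_ge0 !mono//; split=> //.
pose m := Num.max a c.
have pm : positv alpha m by rewrite /m; case: (leP a c).
apply: (@le_of_natSinv _ _ _ (`|q| * g m)) => n.
set N := n.+1%:R; have N0 : 0 < N :> R by rewrite ltr0n.
have N1 : 1 <= N :> R by rewrite ler1n.
(* the nodes of the subdivided segment *)
pose t (k : nat) : R := k%:R / N.
have t0 k : 0 <= t k by rewrite divr_ge0// ltW.
have tS k : t k <= t k.+1 by rewrite ler_wpM2r ?invr_ge0 ?ler_nat// ltW.
have tSgt0 k : 0 < t k.+1 by rewrite divr_gt0.
have tle1 k : (k <= n.+1)%N -> t k <= 1 by move=> kn; rewrite ler_pdivrMr// mul1r ler_nat.
have dt k : t k.+1 - t k = N^-1 by rewrite /t -mulrBl -natrB// subSnn mul1r.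
have tN : t n.+1 = 1 by rewrite /t divff// gt_eqF.
pose A k := a' + t k * p; pose B k := b' + t k * q; pose C k := c' + t k * r.
have posA k : (k < n.+1)%N -> positv alpha (A k.+1).
  move=> kn; apply: positv_le pa _ _; first by rewrite ltr_wpDl// mulr_gt0.
  by rewrite /A -lerBrDl ler_piMl ?tle1// ltW.
have posC k : (k < n.+1)%N -> positv alpha (C k.+1).
  move=> kn; apply: positv_le pc _ _; first by rewrite ltr_wpDl// mulr_gt0.
  by rewrite /C -lerBrDl ler_piMl ?tle1// ltW.
have incr u v k : u + t k.+1 * v - (u + t k * v) = N^-1 * v.
  by rewrite -(dt k); ring.
(* the increment of the off-diagonal entry is compared with the diagonal
   increments one step later *)
have step k : (k < n)%N -> psd2 (f (A k.+2) - f (A k.+1)) (f (B k.+1) - f (B k))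
                                (f (C k.+2) - f (C k.+1)).
  move=> kn; have kn' : (k < n.+1)%N by exact: ltnW.
  have [pA1 pC1] := (posA _ kn', posC _ kn').
  have [pA2 pC2] := (posA k.+1 kn, posC k.+1 kn).
  have gA := C1 _ _ pA1 pA2 _; have gC := C1 _ _ pC1 pC2 _.
  rewrite !incr in gA gC.
  apply: (psd2_le (gA _) (gC _)).
  - by rewrite lerD2l ler_wpM2r// ltW.
  - by rewrite lerD2l ler_wpM2r// ltW.
  set M := Num.sqrt (A k.+1 * C k.+1).
  have [A0 C0] := (positv_gt0 pA1, positv_gt0 pC1).
  have M0 : 0 < M by rewrite sqrtr_gt0 mulr_gt0.
  have pM : positv alpha M.
    apply/positvE; split=> //.
    apply: (psd2_symitv (positv_sym pA1) (positv_sym pC1)).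
    by split; [exact: ltW|exact: ltW|rewrite sqr_sqrtr// mulr_ge0// ltW].
  have BM : `|B k| <= M by exact: psd2_path_le.
  have BM1 : `|B k.+1| <= M by exact: psd2_path_le.
  have gM : g M <= Num.sqrt (g (A k.+1) * g (C k.+1)) by exact: gsqrt.
  have fB : `|f (B k.+1) - f (B k)| <= N^-1 * `|q| * g M.
    rewrite !ler_norml in BM BM1; case/andP: BM => B1 B2; case/andP: BM1 => B3 B4.
    have [q0|q0] := leP 0 q.
      have BB : B k <= B k.+1 by rewrite lerD2l ler_wpM2r.
      by have := C2 _ _ _ pM B1 BB B4; rewrite incr (ger0_norm q0).
    have BB : B k.+1 <= B k by rewrite lerD2l ler_wnM2r// ltW.
    have BBq : B k - B k.+1 = N^-1 * `|q| by rewrite -opprB incr (ltr0_norm q0) mulrN.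
    by have := C2 _ _ _ pM B3 BB B2; rewrite distrC BBq.
  have Ni : 0 <= N^-1 by rewrite invr_ge0 ltW.
  split; rewrite ?mulr_ge0 ?g0 ?(ltW p_gt0) ?(ltW r_gt0)//.
  case: pD => _ _ qpr.
  rewrite -real_normK ?num_real//.
  apply: (@le_trans _ _ ((N^-1 * `|q| * Num.sqrt (g (A k.+1) * g (C k.+1))) ^+ 2)).
    rewrite ler_pXn2r ?nnegrE ?mulr_ge0 ?sqrtr_ge0// (le_trans fB)//.
    by rewrite ler_wpM2l// mulr_ge0.
  rewrite !exprMn sqr_sqrtr ?mulr_ge0 ?g0// real_normK ?num_real//.
  rewrite [leRHS](_ : _ = N^-1 ^+ 2 * (p * r) * (g (A k.+1) * g (C k.+1))); last by ring.
  by rewrite ler_wpM2r ?mulr_ge0 ?g0// ler_wpM2l// sqr_ge0.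
have total := psd2_sum step.
have tele (u : nat -> R) : \sum_(k < n) (u k.+1 - u k) = u n - u 0%N.
  by rewrite -(big_mkord xpredT (fun k => u k.+1 - u k)) telescope_sumr.
rewrite (tele (fun k => f (A k.+1))) (tele (fun k => f (B k)))
  (tele (fun k => f (C k.+1))) in total.
have AN : A n.+1 = a by rewrite /A tN /p; ring.
have CN : C n.+1 = c by rewrite /C tN /r; ring.
have BN : B n.+1 = b by rewrite /B tN /q; ring.
have B0 : B 0%N = b' by rewrite /B /t mul0r mul0r addr0.
rewrite AN CN B0 in total.
have /psd2_normE[_ _ main] : psd2 (f a - f a') (f (B n) - f b') (f c - f c').
  apply: psd2_le total.
    rewrite lerD2l lerN2; apply: mono => //; first exact: posA.
    by rewrite lerDl mulr_ge0// ltW.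
  rewrite lerD2l lerN2; apply: mono => //; first exact: posC.
  by rewrite lerDl mulr_ge0// ltW.
have last : `|f b - f (B n)| <= `|q| * g m / N.
  have bm := psd2_norm_le_max pA.
  have b'm : `|B n| <= m.
    have H : psd2 a (B n) c.
      apply: (@psd2_le _ (A n) _ (C n)).
      - by rewrite -AN lerD2l ler_wpM2r// ltW.
      - by rewrite -CN lerD2l ler_wpM2r// ltW.
      - by apply: psd2D => //; exact: psd2Z.
    exact: psd2_norm_le_max H.
  have bB : b - B n = N^-1 * q by rewrite -BN incr.
  rewrite !ler_norml in bm b'm; case/andP: bm => B1 B2; case/andP: b'm => B3 B4.
  rewrite (mulrC (`|q| * _)) mulrA -[N^-1]gtr0_norm ?invr_gt0// -normrM -bB.
  have [q0|q0] := leP (B n) b.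
    by rewrite (ger0_norm (_ : 0 <= b - _)) ?subr_ge0//; exact: C2.
  rewrite distrC (distrC b) (gtr0_norm (_ : 0 < B n - b)) ?subr_gt0//.
  by apply: C2 => //; exact: ltW.
rewrite [X in `|X|](_ : _ = (f (B n) - f b') + (f b - f (B n))); last by ring.
by rewrite (le_trans (ler_normD _ _))// lerD.
Qed.

End ControlledSmono.

(** * Difference quotients and convexity along segments *)

Section Derivatives.
Context {R : realType}.
Implicit Types (f phi : R -> R) (x y : R).

Definition quotient f x h := (f (x + h) - f x) / h.

Lemma derivable_quotient f x : derivable f x 1 -> forall e, 0 < e ->
  exists2 d, 0 < d & forall h, h != 0 -> `|h| < d ->
    `|quotient f x h - derive1 f x| <= e.
Proof.
move=> df e e0.
have /cvgrPdist_le/(_ _ e0) := df.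
case/nbhs_ballP => d /= d0 H; exists d => // h h0 hd.
have := H h; rewrite -ball_normE/= sub0r normrN => /(_ hd h0).
rewrite distrC /quotient derive1E [_ *: 1]mulr1 (addrC x) mulrC.
exact: le_trans.
Qed.

(** The limit need not be known: the line is complete. *)
Lemma cauchy_quotient_derivable f x :
  (forall e, 0 < e -> exists2 d, 0 < d & forall h k, h != 0 -> k != 0 ->
    `|h| < d -> `|k| < d -> `|quotient f x h - quotient f x k| <= e) ->
  derivable f x 1.
Proof.
move=> H; rewrite /derivable.
apply: (@cauchy_cvg R^o _ _); apply: cauchy_exP => e e0.
have [d d0 {}H] := H (e / 2) (divr_gt0 e0 (ltr0Sn R 1)).
pose h := d / 2.
have h0 : 0 < h by rewrite divr_gt0.
have hd : `|h| < d by rewrite gtr0_norm// /h; lra.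
exists (quotient f x h).
suff : \forall k \near (0 : R)^', ball (quotient f x h) e
    (k^-1 *: (f (k *: 1 + x) - f x)) by [].
near=> k.
have k0 : k != 0 by near: k; exact: nbhs_dnbhs_neq.
have kd : `|k| < d by near: k; apply: dnbhs0_lt.
rewrite -ball_normE/=.
have := H h k (lt0r_neq0 h0) k0 hd kd.
rewrite /quotient [_ *: 1]mulr1 (addrC k) [_ *: (_ - _)]mulrC => /le_lt_trans; apply.
lra.
Unshelve. all: by end_near. Qed.

Lemma chord_le_derive phi : derivable phi 0 1 -> derivable phi 1 1 ->
  (forall l, 0 <= l <= 1 -> phi l <= l * phi 1 + (1 - l) * phi 0) ->
  derive1 phi 0 <= phi 1 - phi 0 <= derive1 phi 1.
Proof.
move=> d0 d1 H; apply/andP; split; apply/ler_addgt0Pr => e e0.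
  have [d dgt0 Hd] := derivable_quotient d0 e0.
  pose h := Num.min (1/2) (d / 2).
  have h0 : 0 < h by rewrite lt_min !divr_gt0.
  have h1 : h <= 1 / 2 by rewrite ge_min lexx.
  have hd : h <= d / 2 by rewrite ge_min lexx orbT.
  have := Hd h (lt0r_neq0 h0); rewrite gtr0_norm// => /(_ ltac:(lra)).
  rewrite /quotient add0r => /ler_normlP[+ _].
  have : (phi h - phi 0) / h <= phi 1 - phi 0.
    by rewrite ler_pdivrMr//; have := H h ltac:(lra); lra.
  lra.
have [d dgt0 Hd] := derivable_quotient d1 e0.
pose h := Num.min (1/2) (d / 2).
have h0 : 0 < h by rewrite lt_min !divr_gt0.
have h1 : h <= 1 / 2 by rewrite ge_min lexx.
have hd : h <= d / 2 by rewrite ge_min lexx orbT.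
have := Hd (- h); rewrite oppr_eq0 normrN (gtr0_norm h0) => /(_ (lt0r_neq0 h0) ltac:(lra)).
rewrite /quotient invrN mulrN -mulNr opprB => /ler_normlP[_].
have : phi 1 - phi 0 <= (phi 1 - phi (1 - h)) / h.
  by rewrite ler_pdivlMr//; have := H (1 - h) ltac:(lra); lra.
lra.
Qed.

Lemma convex_of_derive_nondecreasing phi :
  (forall t, 0 <= t <= 1 -> derivable phi t 1) ->
  (forall s t, 0 <= s -> s <= t -> t <= 1 -> derive1 phi s <= derive1 phi t) ->
  forall l, 0 <= l <= 1 -> phi l <= l * phi 1 + (1 - l) * phi 0.
Proof.
move=> D N l /andP[]; rewrite le_eqVlt => /orP[/eqP<- _|l0]; first by lra.
rewrite le_eqVlt => /orP[/eqP->|l1]; first by lra.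
have mvt a b : 0 <= a -> a < b -> b <= 1 ->
    exists2 c, a < c < b & phi b - phi a = derive1 phi c * (b - a).
  move=> a0 ab b1.
  have Dab x : x \in `[a, b]%R -> derivable phi x 1.
    by rewrite in_itv/= => /andP[ax xb]; apply: D; lra.
  have [|c cab E] := @MVT R phi (derive1 phi) a b ab _
     (derivable_within_continuous Dab).
    move=> x xab; rewrite derive1E; apply/derivableP/Dab.
    by move: xab; rewrite !in_itv/= => /andP[/ltW-> /ltW->].
  by exists c => //; rewrite in_itv in cab.
have [c /andP[c0 cl] Ec] := mvt 0 l (lexx 0) l0 (ltW l1).
have [d /andP[ld d1] Ed] := mvt l 1 (ltW l0) l1 (lexx 1).
have := N c d (ltW c0) ltac:(lra) (ltW d1).
have -> : l * phi 1 + (1 - l) * phi 0 =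
  phi l + l * (phi 1 - phi l) - (1 - l) * (phi l - phi 0) by ring.
rewrite Ec Ed subr0 => dd.
have : 0 <= (l * (1 - l)) * (derive1 phi d - derive1 phi c).
  by rewrite !mulr_ge0 ?subr_ge0 ?(ltW l0) ?(ltW l1).
lra.
Qed.

Lemma derivable_affine_comp f u v t : derivable f (u + t * v) 1 ->
  is_derive t 1 (fun s => f (u + s * v)) (derive1 f (u + t * v) * v).
Proof.
move=> df.
have df' : is_derive (u + t * v) 1 f (derive1 f (u + t * v)).
  by rewrite derive1E; apply/derivableP.
have da : is_derive t 1 (fun s : R => u + s * v) v.
  have : is_derive t 1 (cst u + v \*: id : R -> R) (0 + v *: 1).
    by apply: is_deriveD; exact: is_deriveZ.
  rewrite add0r [_ *: 1]mulr1; congr (is_derive _ _ _ _).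
  by apply/funext => s /=; rewrite /cst /GRing.add/= mulrC.
have H := @is_derive1_comp R f (fun s => u + s * v) t _ v df' da.
exact: H.
Qed.

Lemma quadratic_path f (a b c p q r x y t : R) :
  derivable f (a + t * p) 1 -> derivable f (b + t * q) 1 ->
  derivable f (c + t * r) 1 ->
  let phi s := f (a + s * p) * x ^+ 2 + 2 * f (b + s * q) * x * y +
    f (c + s * r) * y ^+ 2 in
  derivable phi t 1 /\
  derive1 phi t = p * derive1 f (a + t * p) * x ^+ 2 +
    2 * (q * derive1 f (b + t * q)) * x * y + r * derive1 f (c + t * r) * y ^+ 2.
Proof.
move=> /derivable_affine_comp da /derivable_affine_comp db /derivable_affine_comp dc phi.
have := is_deriveD (is_deriveD (is_deriveZ (x ^+ 2) da)
  (is_deriveZ (2 * x * y) db)) (is_deriveZ (y ^+ 2) dc).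
set F := (X in is_derive _ _ X _).
have -> : F = phi.
  apply/funext => s; rewrite /phi.
  transitivity (x ^+ 2 * f (a + s * p) + 2 * x * y * f (b + s * q) +
    y ^+ 2 * f (c + s * r)); first by [].
  by ring.
move=> D; split; first by case: D.
case: D => _ D; rewrite derive1E D.
transitivity (x ^+ 2 * (derive1 f (a + t * p) * p) +
  2 * x * y * (derive1 f (b + t * q) * q) +
  y ^+ 2 * (derive1 f (c + t * r) * r)); first by [].
by ring.
Qed.

End Derivatives.

(** * Operator convexity through the derivative *)

Section SconvJensen.
Context {R : realType} (alpha : \bar R).
Implicit Types (f : R -> R) (x y s d l : R).

Lemma loewner_pair_path a b c a' b' c' t : loewner_pair alpha a b c a' b' c' ->
  0 <= t <= 1 ->
  [/\ symitv alpha (a' + t * (a - a')), symitv alpha (b' + t * (b - b'))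
    & symitv alpha (c' + t * (c - c'))].
Proof.
move=> pair t01; have pA := loewner_pair_psd2 pair.
have [sa' sc'] := loewner_pair_sym pair; case: pair => sa sc _ pB.
have e u v : u + t * (v - u) = t * v + (1 - t) * u by ring.
rewrite !e; split; apply: symitv_conv => //.
  exact: psd2_symitv pA.
exact: psd2_symitv pB.
Qed.

(** The derivative of a quadratic form along the segment is the quadratic form of
    the Schur product of A - B with f' at the current matrix; it increases by the
    Schur product theorem, so that the form is convex in the parameter. *)
Lemma derive_Smono2_Sconv2 f : differentiable_on alpha f ->
  Smono 2 alpha (derive1 f) -> Sconv 2 alpha f.
Proof.
move=> df /Smono2P mf; apply/Sconv2P => a b c a' b' c' l pair l01.
apply/psd2P => x y.
pose phi s := f (a' + s * (a - a')) * x ^+ 2 + 2 * f (b' + s * (b - b')) * x * y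
  + f (c' + s * (c - c')) * y ^+ 2.
have dphi t : 0 <= t <= 1 -> derivable phi t 1 /\ derive1 phi t =
    (a - a') * derive1 f (a' + t * (a - a')) * x ^+ 2 +
    2 * ((b - b') * derive1 f (b' + t * (b - b'))) * x * y +
    (c - c') * derive1 f (c' + t * (c - c')) * y ^+ 2.
  move=> t01; have [? ? ?] := loewner_pair_path pair t01.
  by apply: quadratic_path; exact: df.
suff : phi l <= l * phi 1 + (1 - l) * phi 0.
  rewrite /phi !mul0r !addr0 !mul1r !subrKC /jensen.
  have e u v : u + l * (v - u) = l * v + (1 - l) * u by ring.
  rewrite !e; lra.
apply: convex_of_derive_nondecreasing => // [t /dphi[]//|s t s0 st t1].
have s01 : 0 <= s <= 1 by lra.
have t01 : 0 <= t <= 1 by lra.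
have [_ ->] := dphi s s01; have [_ ->] := dphi t t01.
have [sta _ stc] := loewner_pair_path pair t01.
case: (pair) => _ _ pD pB.
have pair' : loewner_pair alpha
    (a' + t * (a - a')) (b' + t * (b - b')) (c' + t * (c - c'))
    (a' + s * (a - a')) (b' + s * (b - b')) (c' + s * (c - c')).
  split=> //; last by apply: psd2D => //; exact: psd2Z.
  have e u v : u + t * v - (u + s * v) = (t - s) * v by ring.
  by rewrite !e; apply: psd2Z => //; rewrite subr_ge0.
have /psd2P/(_ x y) := psd2M pD (mf _ _ _ _ _ _ pair').
lra.
Qed.

Definition jensen_dominated f := forall l x s d, 0 <= l <= 1 -> `|x| <= s ->
  0 <= d -> symitv alpha (s + d) ->
  `|jensen f l (x + d) x| <= jensen f l (s + d) s.

(** The same pair of matrices as for [Smono2_increments]. *)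
Lemma Sconv2_jensen f : Sconv 2 alpha f -> jensen_dominated f.
Proof.
move=> /Sconv2P H l x s d l01 xs d0 ssd.
have s0 : 0 <= s by rewrite (le_trans _ xs).
have := H (s + d) (x + d) (s + d) s x s l.
case=> [||F0 _] //.
  split=> //; first by rewrite !(addrC _ d) !addrK; split.
  by split=> //; rewrite -expr2 -(real_normK (num_real x)) ler_pXn2r ?nnegrE.
by rewrite -expr2 -(real_normK (num_real (jensen _ _ _ x))) ler_pXn2r ?nnegrE.
Qed.

Section JensenDominated.
Variable f : R -> R.
Hypothesis Jf : jensen_dominated f.

(** On the nonnegative side take x = s in the domination hypothesis: the defect
    is nonnegative, that is, f is convex there. *)
Lemma jensen_chord u v t : 0 <= u -> u < v -> v < t -> symitv alpha t ->
  (f v - f u) * (t - v) <= (f t - f v) * (v - u).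
Proof.
move=> u0 uv vt st.
have ut : 0 < t - u by lra.
pose l := (v - u) / (t - u).
have l01 : 0 <= l <= 1.
  apply/andP; split; last by rewrite ler_pdivrMr//; lra.
  by rewrite /l divr_ge0 ?subr_ge0 ?ltW// (lt_trans uv).
have := Jf l01 (_ : `|u| <= u) (ltW ut).
rewrite subrKC ger0_norm// => /(_ (lexx u) st) /(le_trans (normr_ge0 _)).
rewrite /jensen.
have -> : l * t + (1 - l) * u = v by rewrite /l; field; rewrite gt_eqF.
rewrite -(pmulr_rge0 _ ut).
have -> : (t - u) * (l * f t + (1 - l) * f u - f v) =
   (v - u) * f t + (t - v) * f u - (t - u) * f v.
  by rewrite /l; field; rewrite gt_eqF.
lra.
Qed.

Lemma jensen_slopes u v w t : 0 <= u -> u < v -> v <= w -> w < t -> symitv alpha t ->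
  (f v - f u) * (t - w) <= (f t - f w) * (v - u).
Proof.
move=> u0 uv; rewrite le_eqVlt => /orP[/eqP<-|vw wt st].
  exact: jensen_chord.
have sw : symitv alpha w by apply: symitv_le st _; rewrite !ger0_norm; lra.
have H1 := jensen_chord u0 uv vw sw.
have H2 := jensen_chord (_ : 0 <= v) vw wt st.
have {}H2 := H2 ltac:(lra).
have wv : 0 < w - v by lra.
rewrite -(ler_pM2r wv).
have K1 := ler_wpM2r (_ : 0 <= t - w) H1.
have K2 := ler_wpM2r (_ : 0 <= v - u) H2.
have {}K1 := K1 ltac:(lra); have {}K2 := K2 ltac:(lra).
lra.
Qed.

(** By convexity the slope just after y is at least the slope over [y - d, y]. *)
Lemma jensen_le_second_difference l y d : 0 <= l <= 1 -> 0 < d -> d <= y ->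
  symitv alpha (y + d) ->
  jensen f l (y + d) y <= l * (f (y + d) - f y - (f y - f (y - d))).
Proof.
move=> /andP[]; rewrite le_eqVlt => /orP[/eqP<- _|l0 l1] d0 dy sy.
  by rewrite /jensen !mul0r add0r subr0 !mul1r add0r subrr.
have ld : 0 < l * d by rewrite mulr_gt0.
have ld1 : l * d <= d by rewrite ler_piMl// ltW.
have sl : symitv alpha (y + l * d).
  by apply: symitv_le sy _; rewrite !ger0_norm; lra.
have := @jensen_slopes (y - d) y y (y + l * d) ltac:(lra) ltac:(lra) (lexx y) ltac:(lra) sl.
rewrite /jensen (_ : l * (y + d) + (1 - l) * y = y + l * d); last by ring.
rewrite addrAC subrr add0r subKr => H.
have : l * (f y - f (y - d)) <= f (y + l * d) - f y.
  by rewrite -(ler_pM2r d0); lra.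
lra.
Qed.

(** The defect at s is at most the defects at s + k d for k < n, hence at most
    the average of n second differences of step d.  That sum telescopes to the
    difference of two increments over steps of length d, which is at most M d
    because the slopes of f near s are bounded.  The gain is the factor n. *)
Lemma jensen_small s : 0 < s -> symitv alpha s -> (0 < alpha)%E ->
  exists M eta, [/\ 0 <= M, 0 < eta, symitv alpha (s + eta) &
    forall n l d, 0 <= l <= 1 -> 0 < d -> n.+1%:R * d <= eta ->
      n%:R * jensen f l (s + d) s <= l * (M * d)].
Proof.
move=> s0 ss a0.
have [m /positvE[m0 sm]] := symitv_lt_exists a0 ss.
rewrite (gtr0_norm s0) => lt_sm.
pose z := (s + m) / 2.
pose hi := (f m - f z) / (m - z); pose lo := (f (s / 2) - f 0) / (s / 2).
have zm : z < m by rewrite /z; lra.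
have sz : s < z by rewrite /z; lra.
have lohi : lo <= hi.
  rewrite ler_pdivrMr ?divr_gt0// mulrAC ler_pdivlMr ?subr_gt0//.
  by have := @jensen_slopes 0 (s / 2) z m (lexx 0); rewrite subr0; apply=> //; lra.
exists (hi - lo), (Num.min (z - s) (s / 2)).
split; [by rewrite subr_ge0|by rewrite lt_min divr_gt0// andbT subr_gt0| |].
  have emin : Num.min (z - s) (s / 2) <= z - s by rewrite ge_min lexx.
  have : 0 < Num.min (z - s) (s / 2) by rewrite lt_min divr_gt0// andbT subr_gt0.
  move: (Num.min _ _) emin => eta ez eta0.
  apply: symitv_le sm _; rewrite (ger0_norm (ltW m0)) gtr0_norm; last exact: addr_gt0.
  by rewrite (le_trans _ (ltW zm))// -lerBrDl.
move=> n l d l01 d0; rewrite le_min mulr_natSl => /andP[nz ns].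
have nd0 : 0 <= n%:R * d by rewrite mulr_ge0// ltW.
have bound y : s <= y -> y + d <= z -> f (y + d) - f y <= hi * d.
  move=> sy ydz.
  rewrite -ler_pdivrMr// ler_pdivlMr ?subr_gt0// mulrAC ler_pdivrMr//.
  have := @jensen_slopes y (y + d) z m ltac:(lra) ltac:(lra) ydz zm sm.
  by rewrite (addrC y) addrK.
have bound0 : lo * d <= f s - f (s - d).
  rewrite -ler_pdivlMr// ler_pdivrMr ?divr_gt0// mulrAC ler_pdivlMr//.
  have := @jensen_slopes 0 (s / 2) (s - d) s (lexx 0) ltac:(lra) ltac:(lra) ltac:(lra) ss.
  by rewrite subr0 subKr.
have key k : (k <= n)%N -> s + k%:R * d + d <= z.
  move=> kn; suff : k%:R * d <= n%:R * d by lra.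
  by rewrite ler_wpM2r ?ler_nat// ltW.
have [n0|npos] := posnP n.
  rewrite n0 mul0r !mulr_ge0 ?subr_ge0 ?(ltW d0)//; by case/andP: l01.
pose v y := f y - f (y - d).
have main : n%:R * jensen f l (s + d) s <= l * (v (s + n%:R * d) - v s).
  have [l0 l1] := andP l01.
  move: l0; rewrite le_eqVlt => /orP[/eqP<-|l0].
    by rewrite mul0r /jensen !mul0r add0r subr0 !mul1r add0r subrr mulr0.
  rewrite -ler_pdivrMl// mulrCA; apply: telescope_increments_ge => k kn.
  rewrite ler_pdivrMl// /v addrK.
  have kd : 0 <= k%:R * d by rewrite mulr_ge0// ltW.
  have sk : symitv alpha (s + k%:R * d + d).
    by apply: symitv_le sm _; rewrite !ger0_norm; have := key k (ltnW kn); lra.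
  apply: le_trans (jensen_le_second_difference l01 d0 _ sk); last by lra.
  have sx : `|s| <= s + k%:R * d by rewrite gtr0_norm// lerDl.
  exact: le_trans (ler_norm _) (Jf l01 sx (ltW d0) sk).
apply: (le_trans main); rewrite ler_wpM2l//; first by case/andP: l01.
have := bound (s + n.-1%:R * d).
have e : s + n.-1%:R * d + d = s + n%:R * d.
  by rewrite -[in RHS](prednK npos) mulr_natSl addrA.
rewrite e /v -e addrK.
have := key n.-1 (leq_pred n).
have : 0 <= n.-1%:R * d by rewrite mulr_ge0// ltW.
move=> h1 h2 /(_ ltac:(lra) h2).
lra.
Qed.

End JensenDominated.


End SconvJensen.

Section SconvDerivative.
Context {R : realType} (alpha : \bar R).
Implicit Types (f : R -> R) (x y s d l : R).

(** For 0 < h <= d the defect with weight h / d over [x, x + d] is h times the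
    difference of the quotients at d and h; with weight 1 / 2 over [x - d, x + d]
    it compares the quotients at d and - d.  Both comparisons have precision
    O(1 / n), and together they reach all pairs of nonzero increments. *)
Lemma jensen_dominated_differentiable f : (0 < alpha)%E ->
  jensen_dominated alpha f -> differentiable_on alpha f.
Proof.
move=> a0 Jf x sx; apply: cauchy_quotient_derivable => e e0.
have [s /positvE[s0 ss] xs] := symitv_lt_exists a0 sx.
have [M [eta [M0 eta0 sse small]]] := jensen_small Jf s0 ss a0.
have [n [n0 ne]] : exists n : nat, 0 < n%:R :> R /\ 5 * M <= n%:R * e.
  exists (Num.bound (5 * M / e)).+1; rewrite ltr0n; split=> //.
  rewrite -ler_pdivrMr// ltW// (lt_le_trans (archi_boundP _))//.
    by rewrite divr_ge0 ?mulr_ge0// ltW.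
  by rewrite ler_nat.
have nn0 : 0 < n.+1%:R :> R by rewrite ltr0n.
pose d0 := Num.min (s - `|x|) (eta / (2 * n.+1%:R)).
exists d0; first by rewrite lt_min subr_gt0 xs divr_gt0// mulr_gt0.
pose q := quotient f x.
have range d : 0 < d -> d < d0 -> [/\ d <= s - `|x|, n.+1%:R * d <= eta,
   n.+1%:R * (2 * d) <= eta & symitv alpha (s + 2 * d)].
  move=> dp; rewrite lt_min => /andP[/ltW d1].
  rewrite ltr_pdivlMr ?mulr_gt0// => d2.
  have n1 : 1 <= n.+1%:R :> R by rewrite ler1n.
  have : d <= n.+1%:R * d by rewrite ler_peMl// ltW.
  move=> d3; split=> //; [lra|lra|].
  by apply: symitv_le sse _; rewrite !ger0_norm; lra.
have pospos h d : 0 < h -> h <= d -> d < d0 -> n%:R * `|q d - q h| <= M.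
  move=> h0 hd dd0; have dp : 0 < d by lra.
  have [d1 d2 _ d3] := range d dp dd0.
  pose l := h / d.
  have l01 : 0 <= l <= 1.
    by rewrite /l divr_ge0 ?ler_pdivrMr ?mul1r ?(ltW h0) ?(ltW dp).
  have sd : symitv alpha (s + d) by apply: symitv_le d3 _; rewrite !ger0_norm; lra.
  have J := Jf l x s d l01 (ltW xs) (ltW dp) sd.
  have JE : jensen f l (x + d) x = h * (q d - q h).
    rewrite /jensen /q /quotient (_ : l * (x + d) + (1 - l) * x = x + h).
      by rewrite /l; field; rewrite !gt_eqF.
    by rewrite /l; field; rewrite gt_eqF.
  rewrite JE normrM (gtr0_norm h0) in J.
  rewrite -(ler_pM2l h0) mulrCA.
  apply: (le_trans (ler_wpM2l (ltW n0) J)).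
  apply: (le_trans (small _ _ _ l01 dp d2)).
  by rewrite /l mulrCA mulrC divfK ?gt_eqF.
have sym d : 0 < d -> d < d0 -> n%:R * `|q d - q (- d)| <= 2 * M.
  move=> dp dd0; have [d1 d2 d4 d3] := range d dp dd0.
  have l01 : 0 <= (1 / 2 : R) <= 1 by apply/andP; split; lra.
  have xd : `|x - d| <= s.
    by rewrite (le_trans (ler_normB _ _))// (gtr0_norm dp); lra.
  have d20 : 0 < 2 * d by rewrite mulr_gt0.
  have J := Jf (1 / 2) (x - d) s (2 * d) l01 xd (ltW d20) d3.
  have JE : jensen f (1 / 2) (x - d + 2 * d) (x - d) = d / 2 * (q d - q (- d)).
    rewrite /jensen /q /quotient (_ : 1 / 2 * (x - d + 2 * d) + (1 - 1 / 2) * (x - d) = x).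
      by rewrite (_ : x - d + 2 * d = x + d); [field; rewrite gt_eqF|ring].
    by field.
  have dh : 0 < d / 2 by rewrite divr_gt0.
  rewrite JE normrM (gtr0_norm dh) in J.
  rewrite -(ler_pM2l dh) mulrCA.
  apply: (le_trans (ler_wpM2l (ltW n0) J)).
  apply: (le_trans (small _ _ _ l01 d20 d4)).
  lra.
have toabs h : h != 0 -> `|h| < d0 -> n%:R * `|q h - q `|h| | <= 2 * M.
  move=> h0; case: (ltrgt0P h) h0 => // hp _ hd.
    by rewrite subrr normr0 mulr0 mulr_ge0.
  have := sym (- h); rewrite oppr_gt0 opprK distrC; exact.
move=> h k hn kn hd kd.
have hk : n%:R * `|q `|h| - q `|k| | <= M.
  have hp : 0 < `|h| by rewrite normr_gt0.
  have kp : 0 < `|k| by rewrite normr_gt0.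
  have [hk|kh] := leP `|h| `|k|; last exact: pospos (ltW kh) _.
  by rewrite distrC; exact: pospos.
have H1 := toabs h hn hd; have H2 := toabs k kn kd; rewrite distrC in H2.
have tri : `|q h - q k| <= `|q h - q `|h| | + `|q `|h| - q `|k| | + `|q `|k| - q k|.
  rewrite (_ : q h - q k = (q h - q `|h|) + (q `|h| - q `|k|) + (q `|k| - q k)); last by ring.
  by rewrite (le_trans (ler_normD _ _))// lerD2r ler_normD.
rewrite -(ler_pM2l n0); apply: le_trans ne.
have := ler_wpM2l (ltW n0) tri; rewrite !mulrDr; lra.
Qed.

(** A convex function of the parameter has a larger derivative at the end of the
    segment than at its origin. *)
Lemma Sconv2_derive_pair f a b c a' b' c' : differentiable_on alpha f ->
  Sconv 2 alpha f -> loewner_pair alpha a b c a' b' c' ->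
  psd2 ((a - a') * (derive1 f a - derive1 f a'))
    ((b - b') * (derive1 f b - derive1 f b'))
    ((c - c') * (derive1 f c - derive1 f c')).
Proof.
move=> df /Sconv2P H pair; apply/psd2P => x y.
pose phi s := f (a' + s * (a - a')) * x ^+ 2 + 2 * f (b' + s * (b - b')) * x * y
  + f (c' + s * (c - c')) * y ^+ 2.
have dphi t : 0 <= t <= 1 -> derivable phi t 1 /\ derive1 phi t =
    (a - a') * derive1 f (a' + t * (a - a')) * x ^+ 2 +
    2 * ((b - b') * derive1 f (b' + t * (b - b'))) * x * y +
    (c - c') * derive1 f (c' + t * (c - c')) * y ^+ 2.
  move=> t01; have [? ? ?] := loewner_pair_path pair t01.
  by apply: quadratic_path; exact: df.
have z01 : 0 <= (0 : R) <= 1 by rewrite lexx ler01.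
have o01 : 0 <= (1 : R) <= 1 by rewrite lexx ler01.
have [d0 E0] := dphi 0 z01; have [d1 E1] := dphi 1 o01.
have chord l : 0 <= l <= 1 -> phi l <= l * phi 1 + (1 - l) * phi 0.
  move=> l01; have /psd2P/(_ x y) := H _ _ _ _ _ _ _ pair l01.
  rewrite /phi !mul0r !addr0 !mul1r !subrKC /jensen.
  have e u v : u + l * (v - u) = l * v + (1 - l) * u by ring.
  rewrite !e; lra.
have /andP[L U] := chord_le_derive d0 d1 chord.
have LU := le_trans L U.
rewrite E0 E1 !mul0r !addr0 !mul1r !subrKC -subr_ge0 in LU.
by apply: (le_trans LU); rewrite le_eqVlt; apply/orP; left; apply/eqP; ring.
Qed.

(** The factor A - B is removed from the Schur product of [Sconv2_derive_pair] by
    passing to the rank one matrix with the same entries q = b - b' and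
    r = c - c'.  Its upper diagonal entry q ^ 2 / r is at most a - a', and f'
    increases on the nonnegative side, so that nothing is lost by this
    reduction. *)
Lemma Sconv2_derive_Smono2 f : differentiable_on alpha f ->
  Sconv 2 alpha f -> Smono 2 alpha (derive1 f).
Proof.
move=> df cf; apply/Smono2P => a b c a' b' c' pair.
have mono s t : symitv alpha t -> 0 <= s -> s <= t -> derive1 f s <= derive1 f t.
  move=> st s0; rewrite le_eqVlt => /orP[/eqP->//|lt_st].
  have [|+ _ _] := Sconv2_derive_pair df cf (_ : loewner_pair alpha t t t s s s).
    by split=> //; split; rewrite ?expr2 ?subr_ge0// ltW.
  by rewrite pmulr_rge0 ?subr_gt0// subr_ge0.
have [sa' sc'] := loewner_pair_sym pair.
case: (pair) => sa sc [p0 r0 qpr] pB; have [a'0 c'0 _] := pB.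
rewrite !subr_ge0 in p0 r0.
have fa : 0 <= derive1 f a - derive1 f a' by rewrite subr_ge0 mono.
have fc : 0 <= derive1 f c - derive1 f c' by rewrite subr_ge0 mono.
have [bb|bn] := eqVneq b b'.
  by rewrite bb subrr; split=> //; rewrite expr0n mulr_ge0.
set q := b - b' in qpr; have q0 : q != 0 by rewrite subr_eq0.
have q2 : 0 < q ^+ 2 by rewrite exprn_even_gt0.
set r := c - c' in qpr.
have rgt0 : 0 < r.
  rewrite lt_def subr_ge0 r0 andbT; apply/eqP => r00.
  by move: (lt_le_trans q2 qpr); rewrite r00 mulr0 ltxx.
(* the rank one matrix with the same off-diagonal and lower diagonal entries *)
pose p := q ^+ 2 / r.
have pgt0 : 0 < p by rewrite divr_gt0.
have pr : p * r = q ^+ 2 by rewrite divfK// gt_eqF.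
have ple : p <= a - a' by rewrite ler_pdivrMr.
have sap : symitv alpha (a' + p).
  by apply: symitv_le sa _; rewrite !ger0_norm; lra.
have pair1 : loewner_pair alpha (a' + p) b c a' b' c'.
  split=> //; rewrite addrAC subrr add0r -/q -/r.
  by split; [exact: ltW|exact: ltW|rewrite pr].
have := Sconv2_derive_pair df cf pair1.
rewrite addrAC subrr add0r -/q -/r => -[_ _].
rewrite [leRHS](_ : _ = q ^+ 2 *
  ((derive1 f (a' + p) - derive1 f a') * (derive1 f c - derive1 f c'))); last first.
  by rewrite -pr; ring.
rewrite exprMn ler_pM2l// => main.
split=> //; apply: (le_trans main); rewrite ler_wpM2r// lerD2r mono//.
  by rewrite addr_ge0// ltW.
by rewrite -lerBrDl.
Qed.

Lemma Sconv2P_derive f : (0 < alpha)%E -> Sconv 2 alpha f <->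
  differentiable_on alpha f /\ Smono 2 alpha (derive1 f).
Proof.
move=> a0; split=> [cf|[df mf]]; last exact: derive_Smono2_Sconv2.
have df := jensen_dominated_differentiable a0 (Sconv2_jensen cf).
by split=> //; exact: Sconv2_derive_Smono2.
Qed.

End SconvDerivative.

(** * Densities of Lipschitz functions *)

Section LipschitzDensity.
Context {R : realType}.
Local Notation mu := (@lebesgue_measure R).

Lemma stieltjes_itv_oc (F : cumulative R R) (a b : R) : a <= b ->
  lebesgue_stieltjes_measure F `]a, b]%classic = (F b - F a)%:E.
Proof.
move=> ab; rewrite /lebesgue_stieltjes_measure /measure_extension.
by rewrite measurable_mu_extE/= ?wlength_itv_bnd//; exact: is_ocitv.
Qed.

(** If G and x - G x are both nondecreasing, their Stieltjes measures add up to
    Lebesgue measure, since they do so on half-open intervals. *)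
Lemma lipschitz_cumulative (G : R -> R) :
  (forall x y, x <= y -> 0 <= G y - G x <= y - x) ->
  exists2 H : cumulative R R, (H : R -> R) = G &
    forall A, measurable A -> (lebesgue_stieltjes_measure H A <= mu A)%E.
Proof.
have step (F : R -> R) : (forall x y, x <= y -> 0 <= F y - F x <= y - x) ->
    exists H : cumulative R R, (H : R -> R) = F.
  move=> FP.
  have nd : {homo F : x y / x <= y}.
    by move=> x y /FP /andP[]; rewrite subr_ge0.
  have cF : continuous F.
    move=> x; apply/cvgrPdist_le => e e0.
    exists e => //= y; rewrite /ball_/= => xy.
    apply: le_trans (ltW xy).
    have [h|/ltW h] := leP x y.
      by rewrite distrC (distrC x) !ger0_norm ?subr_ge0 ?nd//; case/andP: (FP _ _ h).
    by rewrite !ger0_norm ?subr_ge0 ?nd//; case/andP: (FP _ _ h).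
  have rc : right_continuous F by exact: right_continuousW.
  pose C := isCumulative.Build R _ R F nd rc.
  pose H : cumulative R R := HB.pack F C.
  by exists H.
move=> GP; have [H HE] := step G GP.
have [K KE] := step (fun x => x - G x)
  (fun x y xy => ltac:(have /andP[] := GP x y xy; lra)).
exists H => // A mA.
have -> : mu A = measure_add (lebesgue_stieltjes_measure H)
    (lebesgue_stieltjes_measure K) A.
  apply: lebesgue_measure_unique => // X /ocitvP[->|[[a b]/= ab ->]].
    by rewrite !measure0.
  rewrite [RHS]measure_addE.
  have := stieltjes_itv_oc H (ltW ab); have := stieltjes_itv_oc K (ltW ab).
  rewrite HE KE => EK EH.
  transitivity ((G b - G a)%:E + (b - G b - (a - G a))%:E)%E; last first.
    by congr (_ + _)%E; [exact/esym/EH|exact/esym/EK].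
  rewrite /lebesgue_measure stieltjes_itv_oc ?(ltW ab)//.
  by rewrite -EFinD; congr (_%:E); rewrite /idfun/=; ring.
by rewrite measure_addE leeDl.
Qed.


Lemma clamp_lipschitz (c x y : R) : 0 < c -> x <= y ->
  let cl z := Num.max (- c) (Num.min z c) in
  [/\ - c <= cl x, cl x <= cl y, cl y <= c & cl y - cl x <= y - x].
Proof.
move=> c0 xy cl; have cc : - c <= c by lra.
rewrite /cl; case: (leP x c) => xc; case: (leP y c) => yc;
  rewrite ?(max_r cc); do ?[case: (leP (- c) x) => xc']; do ?[case: (leP (- c) y) => yc'];
  split; lra.
Qed.

Lemma clamp_id (c x : R) : - c <= x <= c -> Num.max (- c) (Num.min x c) = x.
Proof. by move=> /andP[cx xc]; rewrite min_l// max_r. Qed.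

(** G below is nondecreasing and increases at most as fast as the identity; the
    summand x makes it monotone and the clamp extends f outside [-c, c].  Its
    Stieltjes measure on ]-c, c] is finite and has a density rho with respect to
    Lebesgue measure.  Solving the definition of G for f turns rho into the
    density L (2 rho - 1) of f, and the fundamental theorem of calculus for
    Lebesgue integrals makes it the derivative of f almost everywhere. *)
Lemma lipschitz_density (f : R -> R) (c L : R) : 0 < c -> 0 < L ->
  (forall x y, - c <= x -> x <= y -> y <= c -> `|f y - f x| <= (y - x) * L) ->
  exists r : R -> R, [/\ mu.-integrable setT (EFin \o r),
    forall x y, - c <= x -> x <= y -> y <= c ->
      (\int[mu]_(t in `]x, y]) r t)%R = f y - f x &
    {ae mu, forall x, - c < x < c -> derivable f x 1 /\ derive1 f x = r x}].
Proof.
move=> c0 L0 lipf.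
pose cl z := Num.max (- c) (Num.min z c).
pose G x := (x + f (cl x) / L) / 2.
have [|H HE Hle] := @lipschitz_cumulative G.
  move=> x y xy; have [cx cxy cy clip] : [/\ - c <= cl x, cl x <= cl y, cl y <= c
    & cl y - cl x <= y - x] by exact: clamp_lipschitz.
  have := lipf _ _ cx cxy cy; rewrite /G.
  move: (cl x) (cl y) cx cxy cy clip => u v cu uv vc clip /ler_normlP[f1 f2].
  have Li : 0 < L^-1 by rewrite invr_gt0.
  have g1 : (f v - f u) / L <= v - u by rewrite ler_pdivrMr.
  have g2 : - (v - u) <= (f v - f u) / L by rewrite ler_pdivlMr// mulNr lerNl.
  by apply/andP; split; lra.
pose D : set (measurableTypeR R) := `]- c, c]%classic.
have mD : measurable D by exact: measurable_itv.
have Doo : (lebesgue_stieltjes_measure H D < +oo)%E.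
  apply: (le_lt_trans (Hle _ mD)).
  by rewrite lebesgue_measure_itv/=; case: ifP => // _; rewrite -EFinD ltry.
pose nu : {finite_measure set (measurableTypeR R) -> \bar R} := mfrestr mD Doo.
have dom : nu `<< mu.
  apply/null_content_dominatesP => A mA A0.
  apply/eqP; rewrite -measure_le0 -A0; apply: le_trans (Hle _ mA).
  by rewrite /nu /mfrestr /mrestr; apply: le_measure; rewrite ?inE//; exact: measurableI.
have [rho [rho0 rhofin rhoint rhoE]] := radon_nikodym_sigma_finite dom.
pose k t := fine (rho t).
have kE : EFin \o k = rho by apply/funext => t /=; rewrite fineK.
pose r t := L * (2 * k t - \1_D t).
have kint : mu.-integrable setT (EFin \o k) by rewrite kE.
have Dint : mu.-integrable setT (EFin \o \1_D).
  exact: integrable_indic_itv.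
have kint2 := integrableZl measurableT 2 kint.
have bint := integrableB measurableT kint2 Dint.
have rint : mu.-integrable setT (EFin \o r) by exact: (integrableZl measurableT L bint).
have mI x y : @measurable _ (measurableTypeR R) `]x, y]%classic by exact: measurable_itv.
have intS x y h : mu.-integrable setT h -> mu.-integrable `]x, y] h.
  by apply: integrableS.
have rE x y : - c <= x -> x <= y -> y <= c ->
    (\int[mu]_(t in `]x, y]) r t)%R = f y - f x.
  move=> cx xy yc.
  have kxy : (\int[mu]_(t in `]x, y]) k t)%R = G y - G x.
    rewrite /Rintegral -[X in integral _ _ X]/(EFin \o k) kE -rhoE// /nu/= /mfrestr /mrestr.
    rewrite setIidl; first by rewrite stieltjes_itv_oc// HE.
    by apply: subset_itv; rewrite bnd_simp.
  have dxy : (\int[mu]_(t in `]x, y]) \1_D t)%R = y - x.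
    rewrite (@eq_Rintegral _ _ _ _ _ (cst 1)); last first.
      move=> t /[!inE] /= /[!in_itv] /= /andP[xt ty].
      have Dt : D t by rewrite /D/= in_itv/= (le_lt_trans cx xt) (le_trans ty yc).
      by rewrite indicE mem_set.
    rewrite Rintegral_cst// mul1r -[RHS]/(fine (y - x)%:E); congr fine.
    exact: (stieltjes_itv_oc idfun xy).
  rewrite RintegralZl//; last exact: (intS _ _ _ bint).
  rewrite RintegralB//; [|exact: (intS _ _ _ kint2)|exact: intS].
  rewrite RintegralZl//; last exact: intS.
  rewrite kxy dxy /G /cl !clamp_id ?cx ?yc ?(le_trans cx xy) ?(le_trans xy yc)//.
  by field; rewrite gt_eqF.
exists r; split=> //.
have intr y : mu.-integrable [set` Interval (BRight (- c)) (BRight y)] (EFin \o r).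
  exact: intS.
have locr : locally_integrable setT r.
  by apply: open_integrable_locally => //; exact: openT.
have := FTC1 intr locr.
apply: filterS; first exact: (ae_filter_ringOfSetsType mu).
move=> x Hx /andP[cx xc].
have {Hx} := Hx _; rewrite lte_fin => /(_ cx).
pose F y := (\int[mu]_(t in [set` Interval (BRight (- c)) (BRight y)]) r t)%R.
move=> H1; have [dF F'] : derivable F x 1 /\ derive1 F x = r x by exact: H1.
have FE : {near x, (fun y => F y + f (- c)) =1 f}.
  near=> y; rewrite /F rE ?subrK//.
    by apply/ltW; near: y; exact: lt_nbhsr.
  by apply/ltW; near: y; exact: lt_nbhsl.
rewrite derive1E in F'; clearbody F.
have dFx : is_derive x 1 (F : R -> R) (r x) by exact: DeriveDef.
have dF' := is_deriveD dFx (is_derive_cst (f (- c)) x 1).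
have df : derivable f x 1 by apply: near_eq_derivable FE _; case: dF'.
split=> //; rewrite derive1E -(near_eq_derive _ FE).
by case: dF' => _ ->; rewrite addr0.
Unshelve. all: by end_near. Qed.

End LipschitzDensity.

(** * The completed Lebesgue measure *)

Section Completed.
Context {R : realType}.
Local Notation mu := (@lebesgue_measure R).
Local Notation cmu := (@completed_lebesgue_measure R).

Lemma borel_lebesgue_measurable (A : set R) :
  @measurable _ (measurableTypeR R) A -> @measurable _ (lebesgueR R) A.
Proof. exact: sub_caratheodory. Qed.

Lemma itv_lebesgue_measurable (i : interval R) : @measurable _ (lebesgueR R) [set` i].
Proof. by apply: borel_lebesgue_measurable; exact: measurable_itv. Qed.

Lemma completed_itv_oc (a b : R) : a <= b ->
  (cmu : {measure set (lebesgueR R) -> \bar R}) `]a, b]%classic = (b - a)%:E.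
Proof. exact: (stieltjes_itv_oc idfun). Qed.

(** Both notions mean that the outer measure is zero. *)
Lemma negligible_completed (N : set R) : cmu.-negligible N <-> mu.-negligible N.
Proof.
split=> [[A [mA A0 NA]]|[A [mA A0 NA]]]; last first.
  by exists A; split=> //; exact: borel_lebesgue_measurable.
apply/negligible_outer_measure; apply/eqP.
by rewrite eq_le outer_measure_ge0 andbT -A0 le_outer_measure.
Qed.

Lemma ae_completed (P : R -> Prop) :
  {ae cmu, forall x, P x} <-> {ae mu, forall x, P x}.
Proof. exact: negligible_completed. Qed.

Lemma ae_opp (P : R -> Prop) :
  {ae cmu, forall x, P x} -> {ae cmu, forall x, P (- x)}.
Proof.
move=> /ae_completed[A [mA A0 NA]]; apply/ae_completed.
exists (-%R @^-1` A); split.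
- have : measurable_fun setT (-%R : measurableTypeR R -> measurableTypeR R).
    exact: oppr_measurable.
  by move=> /(_ measurableT _ mA); rewrite setTI.
- by rewrite -[RHS]A0 -[RHS]lebesgue_measureN.
- by move=> x Px; apply: NA.
Qed.

Lemma measurable_id_lebesgue :
  measurable_fun setT (id : lebesgueR R -> measurableTypeR R).
Proof. by move=> _ A mA; rewrite setTI; exact: borel_lebesgue_measurable. Qed.

(** Lebesgue measure on Borel sets is the image of the completed measure under
    the identity. *)
Lemma integrable_completed (r : R -> R) (D : set R) :
  mu.-integrable setT (EFin \o r) -> @measurable _ (measurableTypeR R) D ->
  cmu.-integrable D (EFin \o r) /\ \int[cmu]_(x in D) r x = \int[mu]_(x in D) r x.
Proof.
move=> intr mD.
have [mr _] := integrableP _ _ _ intr.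
have mid : measurable_fun (D : set (lebesgueR R)) (id : lebesgueR R -> measurableTypeR R).
  exact: measurable_funTS measurable_id_lebesgue.
have mrc : measurable_fun (D : set (lebesgueR R)) (EFin \o r).
  exact: (measurable_comp measurableT _ mr mid).
have cint : cmu.-integrable D (EFin \o r).
  apply/integrableP; split=> //.
  have /integrableP[mrD] := integrableS measurableT mD (@subsetT _ _) intr.
  have mn : measurable_fun D (fun x : measurableTypeR R => `|(EFin \o r) x|%E).
    exact: measurableT_comp.
  have := ge0_integral_pushforward measurable_id_lebesgue cmu mD mn _.
  by move=> <-.
split=> //; rewrite /Rintegral; congr fine.
exact/esym/(integral_pushforward measurable_id_lebesgue mr cint mD).
Qed.

End Completed.

(** * Integrals of controlled functions *)

Section OneSided.
Context {R : realType}.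
Implicit Types (f : R -> R) (x s d B : R).

(** The factor s, taken to be 1 or -1, selects right or left quotients. *)
Lemma derive_quotient_approx f x s d e : derivable f x 1 -> s != 0 -> 0 < d -> 0 < e ->
  exists2 h, 0 < h < d & `|quotient f x (s * h) - derive1 f x| <= e.
Proof.
move=> df s0 d0 e0; have [d' d'0 H] := derivable_quotient df e0.
have ns : 0 < `|s| by rewrite normr_gt0.
pose h := Num.min (d / 2) (d' / (2 * `|s|)).
have h0 : 0 < h by rewrite lt_min !divr_gt0// mulr_gt0.
have h1 : h <= d / 2 by rewrite ge_min lexx.
have h2 : h <= d' / (2 * `|s|) by rewrite ge_min lexx orbT.
exists h; first by rewrite h0; lra.
apply: H; first by rewrite mulf_neq0// gt_eqF.
rewrite normrM (gtr0_norm h0).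
rewrite ler_pdivlMr ?mulr_gt0// in h2; lra.
Qed.

Lemma derive_ge f x s d B : derivable f x 1 -> s != 0 -> 0 < d ->
  (forall h, 0 < h -> h < d -> B <= quotient f x (s * h)) -> B <= derive1 f x.
Proof.
move=> df s0 d0 H; apply/ler_addgt0Pr => e e0.
have [h /andP[h0 hd] /ler_normlP[_]] := derive_quotient_approx df s0 d0 e0.
by have := H h h0 hd; lra.
Qed.

Lemma derive_le f x s d B : derivable f x 1 -> s != 0 -> 0 < d ->
  (forall h, 0 < h -> h < d -> quotient f x (s * h) <= B) -> derive1 f x <= B.
Proof.
move=> df s0 d0 H; apply/ler_addgt0Pr => e e0.
have [h /andP[h0 hd] /ler_normlP[+ _]] := derive_quotient_approx df s0 d0 e0.
by have := H h h0 hd; lra.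
Qed.

End OneSided.


Section ControlledPsi.
Context {R : realType} (alpha : \bar R).
Local Notation mu := (@lebesgue_measure R).
Local Notation cmu := (@completed_lebesgue_measure R).
Implicit Types (f g : R -> R) (x : R).

(** Densities are obtained on compact intervals only, and countably many of them
    are glued together. *)
Lemma symitv_exhaustion : (0 < alpha)%E -> exists c : nat -> R,
  (forall n, positv alpha (c n)) /\ symitv alpha = \bigcup_n `]- c n, c n[%classic.
Proof.
move=> a0.
suff [c [pc cE]] : exists c : nat -> R, (forall n, positv alpha (c n)) /\
    forall x, symitv alpha x -> exists n, `|x| < c n.
  exists c; split=> //; apply/seteqP; split=> x.
    by move=> /cE[n xn]; exists n => //=; rewrite in_itv/= -ltr_norml.
  move=> [n _ /=]; rewrite in_itv/= => /andP[cx xc].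
  by apply: symitv_between (pc n) (ltW cx) (ltW xc).
rewrite /positv; case: alpha a0 => [r| |]//= r0.
  rewrite lte_fin in r0.
  exists (fun n => r - r / n.+2%:R); split=> [n|x /symitv_abs].
    rewrite !lte_fin subr_gt0 ltrBlDr ltrDl divr_gt0// andbT.
    by rewrite ltr_pdivrMr// ltr_pMr// ltr1n.
  rewrite lte_fin -subr_gt0 => xr.
  exists (Num.bound (r / (r - `|x|))).
  rewrite ltrBrDl -ltrBrDr ltr_pdivrMr// mulrC -ltr_pdivrMr//.
  rewrite (lt_le_trans (archi_boundP _))//; last by rewrite ler_nat ltnW.
  by rewrite divr_ge0 ?(ltW r0) ?(ltW xr).
exists (fun n => n.+1%:R); split=> [n|x _]; first by rewrite lte_fin ltr0n ltry.
exists (Num.bound `|x|); rewrite (lt_le_trans (archi_boundP _))//.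
by rewrite ler_nat.
Qed.

(** The control bounds right quotients from below and left ones from above, both
    by g x. *)
Lemma controlled_derive g f x : (0 < alpha)%E -> controlled alpha g f ->
  positv alpha x -> derivable f x 1 -> derive1 f x = g x.
Proof.
move=> a0 [C1 C2] px df; have [x0 sx] := (positvE alpha x).1 px.
apply/eqP; rewrite eq_le; apply/andP; split.
  apply: (@derive_le _ _ _ (-1) x) => //.
  move=> h h0 hx; rewrite mulN1r /quotient invrN mulrN -mulNr opprB.
  rewrite ler_pdivrMr//; have := C2 x (x - h) x px.
  rewrite subKr mulrC => /(_ ltac:(lra) ltac:(lra) (lexx x)).
  exact/le_trans/ler_norm.
have [m pm xm] := symitv_lt_exists a0 sx; rewrite (gtr0_norm x0) in xm.
apply: (@derive_ge _ _ _ 1 (m - x)) => //; first by rewrite subr_gt0.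
move=> h h0 hm; rewrite mul1r /quotient ler_pdivlMr//.
have pxh : positv alpha (x + h) by apply: positv_le pm _ _; lra.
by have := C1 _ _ px pxh ltac:(lra); rewrite addrAC subrr add0r mulrC.
Qed.

(** The interval [-x, - x + h] is contained in [-x, x], where f is Lipschitz with
    constant g x. *)
Lemma controlled_derive_opp g f x : controlled alpha g f ->
  positv alpha x -> derivable f (- x) 1 -> `|derive1 f (- x)| <= g x.
Proof.
move=> [C1 C2] px df; have x0 := positv_gt0 px.
have H h : 0 < h -> h < x -> `|quotient f (- x) (1 * h)| <= g x.
  move=> h0 hx; rewrite mul1r /quotient normrM normfV (gtr0_norm h0) ler_pdivrMr//.
  have := C2 x (- x) (- x + h) px (lexx _) ltac:(lra) ltac:(lra).
  by rewrite addrAC subrr add0r mulrC.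
rewrite ler_norml; apply/andP; split.
  apply: (@derive_ge _ _ _ 1 x) => // h h0 hx.
  by have := H h h0 hx; rewrite ler_norml => /andP[].
apply: (@derive_le _ _ _ 1 x) => // h h0 hx.
by have := H h h0 hx; rewrite ler_norml => /andP[].
Qed.

(** On the positive side the integrand has to be g itself, since membership in
    [Phi] is required at every point; on the negative side the derivative is taken
    where it exists.  On every compact interval this function agrees almost
    everywhere with a Borel density of f, which gives its measurability, by
    completeness of the measure, and its integrals. *)
Lemma controlled_Psi2 g f : (0 < alpha)%E -> Phi alpha g -> controlled alpha g f ->
  Psi2 alpha f.
Proof.
move=> a0 Pg Cg; have [g0 gnd gsqrt] := Pg.
pose G x := if 0 < x then g x else derive1 f x.
have GE x : positv alpha x -> G x = g x by move=> /positv_gt0 x0; rewrite /G x0.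
have local c : positv alpha c -> exists r : R -> R,
    [/\ mu.-integrable setT (EFin \o r),
      forall x y, - c <= x -> x <= y -> y <= c ->
        (\int[mu]_(t in `]x, y]) r t)%R = f y - f x &
      {ae cmu, forall x, - c < x < c -> derivable f x 1 /\ r x = G x}].
  move=> pc; have [c0 sc] := (positvE alpha c).1 pc.
  have L0 : 0 < g c + 1 by rewrite ltr_wpDl// g0.
  have [|r [ri rE rd]] := @lipschitz_density R f c _ c0 L0.
    move=> x y cx xy yc; apply: (le_trans (Cg.2 c x y pc cx xy yc)).
    by rewrite ler_wpM2l ?subr_ge0// lerDl.
  exists r; split=> //; apply/ae_completed; move: rd.
  apply: filterS; first exact: (ae_filter_ringOfSetsType mu).
  move=> x H cx; have [df <-] := H cx; split=> //.
  rewrite /G; case: ifPn => // x0; apply: (controlled_derive a0 Cg) => //.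
  by apply: positv_le pc x0 _; lra.
have transfer c r (i : interval R) : (forall x, x \in i -> - c < x < c) ->
    mu.-integrable setT (EFin \o r) ->
    {ae cmu, forall x, - c < x < c -> derivable f x 1 /\ r x = G x} ->
    lebesgue_measurable_fun [set` i] G /\
    \int[cmu]_(t in [set` i]) G t = \int[mu]_(t in [set` i]) r t.
  move=> ic ri rd.
  have mI := itv_lebesgue_measurable i.
  have [cri crE] := @integrable_completed R r [set` i] ri (measurable_itv i).
  have rG : ae_eq cmu [set` i] (EFin \o r) (EFin \o G).
    move: rd; apply: filterS; first exact: (ae_filter_ringOfSetsType cmu).
    by move=> t H /ic /H[_] /= ->.
  have [mr _] := integrableP _ _ _ cri.
  have mG := ae_measurable_fun (@completed_lebesgue_measure_is_complete R) rG mr.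
  split; first exact/measurable_EFinP.
  by rewrite -crE /Rintegral (ae_eq_integral _ _ mI mr mG rG).
have integ c : positv alpha c -> forall x y, - c < x -> x <= y -> y < c ->
    \int[cmu]_(t in `[x, y]) G t = f y - f x.
  move=> pc x y cx xy yc; have [r [ri rE rd]] := local c pc.
  have [|_ ->] := transfer c r `[x, y] _ ri rd.
    by move=> t; rewrite in_itv/= => /andP[xt ty]; lra.
  rewrite -Rintegral_itv_obnd_cbnd; last first.
    by apply: integrableS ri => //; exact: measurable_itv.
  by apply: rE => //; exact: ltW.
have [c [pc cE]] := symitv_exhaustion a0.
exists G.
  split.
  - rewrite cE; apply/(measurable_fun_bigcup (T1 := lebesgueR R)) => n.
      exact: itv_lebesgue_measurable.
    have [r [ri _ rd]] := local (c n) (pc n).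
    have H x : x \in `]- c n, c n[ -> - c n < x < c n by rewrite in_itv.
    exact: (transfer (c n) r _ H ri rd).1.
  - split=> [t pt|s t ps pt|s t ps pt]; rewrite ?GE//; [exact: g0|exact: gnd| |].
      exact: gsqrt.
    apply/positvE; split.
      by rewrite sqrtr_gt0 mulr_gt0 ?(positv_gt0 ps) ?(positv_gt0 pt).
    apply: (psd2_symitv (positv_sym ps) (positv_sym pt)).
    have [s0 t0] := (positv_gt0 ps, positv_gt0 pt).
    by split; [exact: ltW|exact: ltW|rewrite sqr_sqrtr// ltW// mulr_gt0].
  - have D : {ae cmu, forall x, symitv alpha x -> derivable f x 1}.
      have : {ae cmu, forall x, forall n, - c n < x < c n -> derivable f x 1}.
        apply: ae_foralln => n; have [r [_ _]] := local (c n) (pc n).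
        apply: filterS; first exact: (ae_filter_ringOfSetsType cmu).
        by move=> x H /H[].
      apply: filterS; first exact: (ae_filter_ringOfSetsType cmu).
      by move=> x H; rewrite cE => -[n _ /=]; rewrite in_itv/=; exact: H.
    have := ae_opp D; apply: filterS; first exact: (ae_filter_ringOfSetsType cmu).
    move=> x H px; rewrite (GE _ px) /G oppr_gt0 ltNge (ltW (positv_gt0 px))/=.
    apply: (controlled_derive_opp Cg px (H _)).
    by apply: symitv_le (positv_sym px) _; rewrite normrN.
move=> t /(symitv_lt_exists a0)[m pm tm].
move: (tm); rewrite ltr_norml => /andP[mt t_m].
have m0 := positv_gt0 pm.
rewrite /oint0; case: leP => t0.
  by rewrite (integ m)//; lra.
by rewrite (integ m) ?opprB// ?ltW//; lra.
Qed.

End ControlledPsi.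

Section BoundedIntegral.
Context {R : realType}.
Local Notation cmu := (@completed_lebesgue_measure R).
Variables (g : R -> R) (m K : R).
Hypothesis K0 : 0 <= K.
Let I : set (lebesgueR R) := `[- m, m]%classic.
Hypothesis mg : lebesgue_measurable_fun I g.
Hypothesis gK : {ae cmu, forall s, I s -> `|g s| <= K}.

Let mI : measurable I. Proof. exact: itv_lebesgue_measurable. Qed.

Let le_abs_integral (A : set (lebesgueR R)) : measurable A -> A `<=` I ->
  (\int[cmu]_(x in A) `|(g x)%:E| <= K%:E * cmu A)%E.
Proof.
move=> mA AI.
rewrite -[leRHS](integral_cst cmu mA K%:E).
have mgA : measurable_fun A (EFin \o g).
  by apply/measurable_EFinP; exact: measurable_funS mI AI mg.
have maA : measurable_fun A (fun x => `|(EFin \o g) x|%E).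
  exact: (measurableT_comp (@abse_measurable R setT) mgA).
have a_ge0 x : A x -> (0 <= `|(EFin \o g) x|)%E by rewrite abse_ge0.
have k_ge0 (x : lebesgueR R) : A x -> (0 <= cst K%:E x)%E by rewrite lee_fin.
apply: (ae_ge0_le_integral mA a_ge0 maA k_ge0 (measurable_cst _)).
move: gK; apply: filterS => x H /AI /H.
by rewrite lee_fin.
Qed.

Let cmuI_lty : (cmu I < +oo)%E.
Proof.
have : (@lebesgue_measure R [set` `[- m, m]%R] < +oo)%E.
  by rewrite lebesgue_measure_itv/=; case: ifP => // _; rewrite -EFinD ltry.
by [].
Qed.

Lemma bounded_integrable (A : set (lebesgueR R)) : measurable A -> A `<=` I ->
  cmu.-integrable A (EFin \o g).
Proof.
move=> mA AI; apply: (integrableS mI) => //; apply/integrableP; split.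
  exact/measurable_EFinP.
apply: le_lt_trans (le_abs_integral mI (@subset_refl _ I)) _.
by rewrite lte_mul_pinfty.
Qed.

Lemma bounded_integral_le (A : set (lebesgueR R)) : measurable A -> A `<=` I ->
  `|\int[cmu]_(x in A) g x| <= K * fine (cmu A).
Proof.
move=> mA AI; have iA := bounded_integrable mA AI.
have fA : cmu A \is a fin_num.
  by rewrite ge0_fin_numE// (le_lt_trans _ cmuI_lty)// le_measure ?inE.
apply: (le_trans (le_normr_Rintegral mA iA)).
rewrite -[leRHS]/(fine K%:E * fine (cmu A)) -fineM// fine_le//.
- exact: integrable_fin_num (integrable_norm iA).
- by rewrite fin_numM.
- exact: le_abs_integral.
Qed.

Lemma bounded_integral_split x y z : - m <= x -> x <= y -> y <= z -> z <= m ->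
  \int[cmu]_(t in `]x, z]) g t =
  \int[cmu]_(t in `]x, y]) g t + \int[cmu]_(t in `]y, z]) g t.
Proof.
move=> mx xy yz zm.
have E : `]x, z]%classic = `]x, y]%classic `|` `]y, z]%classic :> set (lebesgueR R).
  by rewrite (@itv_bndbnd_setU _ _ _ (BRight y))// bnd_simp.
rewrite E Rintegral_setU//; try exact: itv_lebesgue_measurable.
  rewrite -E; apply: bounded_integrable; first exact: itv_lebesgue_measurable.
  by apply: subset_itv; rewrite bnd_simp.
apply/disj_set2P; rewrite -subset0 => t [/=]; rewrite !in_itv/=.
by move=> /andP[_ ty] /andP[yt _]; move: (lt_le_trans yt ty); rewrite ltxx.
Qed.

Lemma bounded_integral_closed x y : - m <= x -> x <= y -> y <= m ->
  \int[cmu]_(t in `[x, y]) g t = \int[cmu]_(t in `]x, y]) g t.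
Proof.
move=> mx xy ym.
have E : `[x, y]%classic = `[x, x]%classic `|` `]x, y]%classic :> set (lebesgueR R).
  by rewrite (@itv_bndbnd_setU _ _ _ (BRight x))// bnd_simp.
rewrite E Rintegral_setU//; try exact: itv_lebesgue_measurable.
- have xI : `[x, x]%classic `<=` I.
    by apply: subset_itv; rewrite bnd_simp// (le_trans xy).
  have := bounded_integral_le (itv_lebesgue_measurable `[x, x]) xI.
  have -> : cmu `[x, x]%classic = 0%E.
    have : @lebesgue_measure R `[x, x]%classic = 0%E by rewrite set_itv1 lebesgue_measure_set1.
    by [].
  by rewrite mulr0 normr_le0 => /eqP ->; rewrite add0r.
- rewrite -E; apply: bounded_integrable; first exact: itv_lebesgue_measurable.
  by apply: subset_itv; rewrite bnd_simp.
apply/disj_set2P; rewrite -subset0 => t [/=]; rewrite !in_itv/=.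
by move=> /andP[_ ty] /andP[yt _]; move: (lt_le_trans yt ty); rewrite ltxx.
Qed.

(** Up to a constant, the oriented integral is the integral from - m. *)
Lemma oint0_sub x y : - m <= x -> x <= y -> y <= m ->
  oint0 g y - oint0 g x = \int[cmu]_(t in `]x, y]) g t.
Proof.
have base z : - m <= z -> z <= m ->
    \int[cmu]_(t in `]- m, z]) g t = \int[cmu]_(t in `]- m, 0]) g t + oint0 g z.
  move=> mz zm; rewrite /oint0; case: leP => z0.
    by rewrite bounded_integral_closed -?bounded_integral_split//; lra.
  rewrite bounded_integral_closed//; [|lra|lra].
  by rewrite (@bounded_integral_split (- m) z 0)//; lra.
move=> mx xy ym.
have xm := le_trans xy ym; have my := le_trans mx xy.
have := @bounded_integral_split (- m) x y (lexx _) mx xy ym.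
rewrite (base y my ym) (base x mx xm) -addrA => /addrI ->.
by rewrite addrAC subrr add0r.
Qed.

End BoundedIntegral.

Section PsiControlled.
Context {R : realType} (alpha : \bar R).
Local Notation cmu := (@completed_lebesgue_measure R).
Implicit Types (f g : R -> R) (x : R).

(** The bound at negative points comes from the almost everywhere inequality
    between g (- t) and g t, and a null set remains null under t -> - t. *)
Lemma Psi1_ae_bounded g m : Psi1 alpha g -> positv alpha m ->
  {ae cmu, forall s, - m <= s <= m -> `|g s| <= g m}.
Proof.
move=> [_ [g0 gnd _] gae] pm.
have n0 : {ae cmu, forall s : R, s != 0}.
  apply/ae_completed; exists [set 0]; split=> //; first exact: lebesgue_measure_set1.
  by move=> s /= /negP/negPn/eqP.
apply: (@filterS2 _ _ (ae_filter_ringOfSetsType cmu) _ _ _ _ n0 (ae_opp gae)).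
move=> s s0 Hs /andP[ms sm].
case: (ltrgt0P s) s0 => // sp _.
  have ps := positv_le pm sp sm.
  by rewrite ger0_norm ?g0// gnd.
have ps : positv alpha (- s).
  by apply: positv_le pm _ _; rewrite ?oppr_gt0// lerNl.
apply: (@le_trans _ _ (g (- s))); last by apply: gnd => //; rewrite lerNl.
by move: (Hs ps); rewrite opprK.
Qed.

(** Both bounds of the control are obtained by integrating pointwise bounds of g
    over ]a, b] and ]x, y]. *)
Lemma Psi2_controlled f : (0 < alpha)%E -> Psi2 alpha f ->
  exists2 g, Phi alpha g & controlled alpha g f.
Proof.
move=> a0 [g gP fE]; exists g; first by case: gP.
have [mg [g0 gnd _] _] := gP.
have msym : @measurable _ (lebesgueR R) (symitv alpha).
  have [c [_ ->]] := symitv_exhaustion a0.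
  by apply: bigcup_measurable => n _; exact: itv_lebesgue_measurable.
have mgm m : positv alpha m -> lebesgue_measurable_fun `[- m, m] g.
  move=> pm; apply: measurable_funS mg => // x /=.
  by rewrite in_itv/= => /andP[mx xm]; exact: symitv_between mx xm.
have inc m x y : positv alpha m -> - m <= x -> x <= y -> y <= m ->
    f y - f x = \int[cmu]_(t in `]x, y]) g t.
  move=> pm mx xy ym.
  have ae : {ae cmu, forall s, `[- m, m]%classic s -> `|g s| <= g m}.
    exact: Psi1_ae_bounded.
  rewrite -(oint0_sub (g0 _ pm) (mgm _ pm) ae mx xy ym).
  rewrite -!fE; first ring.
    by apply: symitv_between pm _ _; lra.
  by apply: symitv_between pm _ _; lra.
split=> [a b pa pb ab|m x y pm mx xy ym].
  have [p0a p0b] := (positv_gt0 pa, positv_gt0 pb).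
  rewrite (inc b a b) //; last by lra.
  have ae : {ae cmu, forall s, `[- b, b]%classic s -> `|g s| <= g b}.
    exact: Psi1_ae_bounded.
  have mI := itv_lebesgue_measurable `]a, b].
  have AI : `]a, b]%classic `<=` `[- b, b]%classic.
    by apply: subset_itv; rewrite bnd_simp//; lra.
  have ig := bounded_integrable (g0 _ pb) (mgm _ pb) ae mI AI.
  have -> : (b - a) * g a = \int[cmu]_(t in `]a, b]) g a.
    by rewrite Rintegral_cst// mulrC; congr (_ * _); rewrite completed_itv_oc.
  apply: le_Rintegral => //.
    apply/integrableP; split; first exact/measurable_EFinP.
    rewrite integral_cst// completed_itv_oc//.
    by rewrite /= ltry.
  move=> t /=; rewrite in_itv/= => /andP[a_t tb].
  by apply: gnd => //; [apply: positv_le pb _ _ => //; lra|exact: ltW].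
have ae : {ae cmu, forall s, `[- m, m]%classic s -> `|g s| <= g m}.
  exact: Psi1_ae_bounded.
rewrite (inc m x y)//.
have mI := itv_lebesgue_measurable `]x, y].
have AI : `]x, y]%classic `<=` `[- m, m]%classic.
  by apply: subset_itv; rewrite bnd_simp.
have := bounded_integral_le (g0 _ pm) (mgm _ pm) ae mI AI.
by rewrite completed_itv_oc// mulrC.
Qed.

Lemma controlled_continuous g f x : (0 < alpha)%E -> Phi alpha g ->
  controlled alpha g f -> symitv alpha x -> {for x, continuous f}.
Proof.
move=> a0 [g0 _ _] [_ C2] sx; have [m pm xm] := symitv_lt_exists a0 sx.
move: xm; rewrite ltr_norml => /andP[mx xm].
have L0 : 0 < g m + 1 by rewrite ltr_wpDl// g0.
have gm : g m <= g m + 1 by rewrite lerDl.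
apply/cvgrPdist_le => e e0; near=> y.
have my : - m < y by near: y; exact: lt_nbhsr.
have ym : y < m by near: y; exact: lt_nbhsl.
have yx : `|x - y| < e / (g m + 1).
  by near: y; apply: cvgr_dist_lt => //; rewrite divr_gt0.
rewrite ltr_pdivlMr// in yx.
have [h|h] := leP x y.
  have := C2 m x y pm (ltW mx) h (ltW ym); rewrite distrC => /le_trans; apply.
  rewrite distrC ger0_norm ?subr_ge0// in yx; apply: le_trans (ltW yx).
  by rewrite ler_wpM2l// subr_ge0.
have := C2 m y x pm (ltW my) (ltW h) (ltW xm) => /le_trans; apply.
rewrite gtr0_norm ?subr_gt0// in yx; apply: le_trans (ltW yx).
by rewrite ler_wpM2l// subr_ge0 ltW.
Unshelve. all: by end_near. Qed.

Lemma Psi2_eq_Smono2 : (0 < alpha)%E -> Psi2 alpha = Smono 2 alpha.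
Proof.
move=> a0; apply/seteqP; split=> f.
  by move=> /(Psi2_controlled a0)[g Pg Cg]; exact: controlled_Smono2 Pg Cg.
by move=> /(Smono2_controlled a0)[Pg Cg]; exact: controlled_Psi2 Pg Cg.
Qed.

End PsiControlled.

Theorem proposition2p4 (R : realType) (alpha : \bar R) (f : R -> R)
    (alpha_gt0 : (0 < alpha)%E) :
  [/\ Sconv 2 alpha f <->
        differentiable_on alpha f /\ Psi2 alpha (derive1 f),
      Psi2 alpha = Smono 2 alpha &
      Sconv 2 alpha f -> continuously_differentiable_on alpha f].
Proof.
rewrite Psi2_eq_Smono2//; have E := Sconv2P_derive f alpha_gt0.
split; [exact: E|exact: erefl|move=> /E[df mf]].
split; [exact: df|move=> x sx].
have [Pg Cg] := Smono2_controlled alpha_gt0 mf.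
exact: controlled_continuous Pg Cg sx.
Qed.
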